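(* There is an algorithm that, given any instance $\mathcal I=(\mathcal K,\mathcal Q,\mathcal C,\alpha,\beta)$ of the two-way-comparison search tree problem with $n=|\mathcal K|$ keys, computes a minimum-cost correct two-way-comparison search tree for $\mathcal I$ in $O(n^4)$ time.
   Context: An instance is a tuple $\mathcal I=(\mathcal K,\mathcal Q,\mathcal C,\alpha,\beta)$ where $\mathcal K=\{K_1<K_2<\dots<K_n\}$ is a set of real keys, $\mathcal Q\subseteq\mathbb R$ is the set of possible queries, $\mathcal C\subseteq\{<,\le,=,\ge,>\}$ is the set of allowed comparison operators, and a probability distribution on $\mathcal Q$ is given by $\beta_i=\Pr[v=K_i]$ and $\alpha_i=\Pr[K_i<v<K_{i+1}]$ (with $\alpha_0=\Pr[v<K_1]$, $\alpha_n=\Pr[v>K_n]$) for a random query $v$. A two-way-comparison search tree (2WCST) is a rooted binary tree whose internal nodes are each labeled by a comparison ''$v\ \mathrm{op}\ K_i$'' with $\mathrm{op}\in\mathcal C$ and $K_i\in\mathcal K$, and have a ''yes'' child and a ''no'' child; a query $v\in\mathcal Q$ is searched by starting at the root and moving to the yes or no child according to whether $v$ satisfies the node's comparison, until a leaf is reached. The tree is correct for $\mathcal I$ if, for every leaf, all queries in $\mathcal Q$ reaching that leaf have the same relation ($<$, $=$ or $>$) to every key in $\mathcal K$ (i.e., the comparisons determine the relation of the query to all keys). The cost of the tree is the expected number of comparisons (internal nodes on the search path) for a random query drawn from the distribution; an optimal tree is a correct one of minimum cost. *)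

(* Defs.v *)
From HB Require Import structures.
From mathcomp Require Import all_boot all_order all_algebra.
From mathcomp Require Import all_classical all_reals all_analysis.

Set Implicit Arguments.
Unset Strict Implicit.
Unset Printing Implicit Defensive.

Import Order.TTheory GRing.Theory Num.Theory.
Local Open Scope classical_set_scope.
Local Open Scope ring_scope.

(** * Two-way-comparison search trees *)

Inductive cmp := CLt | CLe | CEq | CGe | CGt.

Definition cmp_test (R : realType) (o : cmp) (v k : R) : bool :=
  match o with
  | CLt => v < k
  | CLe => v <= k
  | CEq => v == k
  | CGe => v >= k
  | CGt => v > k
  end.

(* Keys are numbered from 0, so K_(i+1) is [key i]; [alpha] keeps its usual
   numbering, [alpha i] being the mass between K_i and K_(i+1). *)
Record instance (R : realType) (n : nat) := Instance {
  key : 'I_n -> R;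
  key_increasing : forall i j : 'I_n, (i < j)%N -> key i < key j;
  queries : set R;
  allowed : pred cmp;
  alpha : 'I_n.+1 -> R;
  beta : 'I_n -> R
}.

(* The open interval between K_i and K_(i+1), with K_0 = -oo, K_(n+1) = +oo. *)
Definition gap (R : realType) (n : nat) (I : instance R n) (i : 'I_n.+1) :
    set R :=
  [set v | forall j : 'I_n, if (j < i)%N then key I j < v else v < key I j].

(* [P] is a law on the query set with the prescribed alpha and beta.  The set
   of queries need not be Borel, hence the form of the first conjunct, which
   for a Borel set of queries says that it has probability 1. *)
Definition query_law (R : realType) (n : nat) (I : instance R n)
    (P : probability (measurableTypeR R) R) : Prop :=
  [/\ forall A : set (measurableTypeR R),
        measurable A -> A `&` queries I = set0 -> P A = 0%E,
      forall i : 'I_n, P [set key I i] = (beta I i)%:E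
    & forall i : 'I_n.+1, P (gap I i) = (alpha I i)%:E].

Inductive tree (n : nat) :=
| Leaf
| Node of cmp & 'I_n & tree n & tree n.  (* operator, key, yes, no *)
Arguments Leaf {n}.

Fixpoint uses_only (n : nat) (C : pred cmp) (T : tree n) : bool :=
  match T with
  | Leaf => true
  | Node o _ y z => [&& C o, uses_only C y & uses_only C z]
  end.

(* The sequence of answers met by [v]; it identifies the leaf reached, and its
   length is the number of comparisons made. *)
Fixpoint search (R : realType) (n : nat) (I : instance R n) (T : tree n)
    (v : R) : seq bool :=
  match T with
  | Leaf => [::]
  | Node o i y z =>
      let b := cmp_test o v (key I i) in
      b :: search I (if b then y else z) v
  end.

Definition correct (R : realType) (n : nat) (I : instance R n) (T : tree n) :
    Prop :=
  uses_only (allowed I) T /\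
  forall u v : R, queries I u -> queries I v ->
    search I T u = search I T v ->
    forall i : 'I_n, [/\ (u < key I i) = (v < key I i),
                         (u == key I i) = (v == key I i)
                       & (u > key I i) = (v > key I i)].

Definition cost (R : realType) (n : nat) (I : instance R n)
    (P : probability (measurableTypeR R) R) (T : tree n) : \bar R :=
  expectation P (fun v : measurableTypeR R => (size (search I T v))%:R : R).

Definition optimal (R : realType) (n : nat) (I : instance R n)
    (P : probability (measurableTypeR R) R) (T : tree n) : Prop :=
  correct I T /\ forall T' : tree n, correct I T' -> (cost I P T <= cost I P T')%E.

(** * A unit-cost real RAM

  Memory consists of natural-number arrays and real arrays; a program refers to
  arrays by literal names, so it uses finitely many of them.  Cells are
  addressed indirectly and hold 0 unless initialised.  The arithmetic is
  addition, (truncated) subtraction and comparison on both sorts: there is no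
  multiplication, which at unit cost would be unrealistically powerful on
  unbounded naturals, and no conversion from reals to naturals.  A program
  contains no real literals, so it makes sense for every [R]. *)

Inductive nexp :=
| NConst of nat
| NGet of nat & nexp          (* array name, address *)
| NAdd of nexp & nexp
| NSub of nexp & nexp.

Inductive rexp :=
| RGet of nat & nexp
| RAdd of rexp & rexp
| RSub of rexp & rexp.

Inductive bexp :=
| BNLt of nexp & nexp
| BRLt of rexp & rexp
| BNot of bexp
| BAnd of bexp & bexp.

Inductive cmd :=
| Skip
| NSet of nat & nexp & nexp   (* array name, address, value *)
| RSet of nat & nexp & rexp
| Seq of cmd & cmd
| If of bexp & cmd & cmd
| While of bexp & cmd.

Record state (R : realType) := State {
  nmem : nat -> nat -> nat;   (* array name, address *)
  rmem : nat -> nat -> R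
}.

Definition upd (T : Type) (m : nat -> nat -> T) (a i : nat) (x : T) :
    nat -> nat -> T :=
  fun a' i' => if (a' == a) && (i' == i) then x else m a' i'.

Fixpoint neval (R : realType) (s : state R) (e : nexp) : nat :=
  match e with
  | NConst k => k
  | NGet a e1 => nmem s a (neval s e1)
  | NAdd e1 e2 => (neval s e1 + neval s e2)%N
  | NSub e1 e2 => (neval s e1 - neval s e2)%N
  end.

Fixpoint reval (R : realType) (s : state R) (e : rexp) : R :=
  match e with
  | RGet a e1 => rmem s a (neval s e1)
  | RAdd e1 e2 => reval s e1 + reval s e2
  | RSub e1 e2 => reval s e1 - reval s e2
  end.

Fixpoint beval (R : realType) (s : state R) (b : bexp) : bool :=
  match b with
  | BNLt e1 e2 => (neval s e1 < neval s e2)%N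
  | BRLt e1 e2 => reval s e1 < reval s e2
  | BNot b1 => ~~ beval s b1
  | BAnd b1 b2 => beval s b1 && beval s b2
  end.

(* Every memory access, operation and constant is charged one unit. *)
Fixpoint ntime (e : nexp) : nat :=
  match e with
  | NConst _ => 1
  | NGet _ e1 => (ntime e1).+1
  | NAdd e1 e2 | NSub e1 e2 => (ntime e1 + ntime e2).+1
  end.

Fixpoint rtime (e : rexp) : nat :=
  match e with
  | RGet _ e1 => (ntime e1).+1
  | RAdd e1 e2 | RSub e1 e2 => (rtime e1 + rtime e2).+1
  end.

Fixpoint btime (b : bexp) : nat :=
  match b with
  | BNLt e1 e2 => (ntime e1 + ntime e2).+1
  | BRLt e1 e2 => (rtime e1 + rtime e2).+1
  | BNot b1 => (btime b1).+1
  | BAnd b1 b2 => (btime b1 + btime b2).+1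
  end.

(* [exec c s s' t]: started in [s], [c] halts in [s'] after time [t]. *)
Inductive exec (R : realType) : cmd -> state R -> state R -> nat -> Prop :=
| ExecSkip s : exec Skip s s 1
| ExecNSet s a e1 e2 :
    exec (NSet a e1 e2) s
      (State (upd (nmem s) a (neval s e1) (neval s e2)) (rmem s))
      (ntime e1 + ntime e2).+1
| ExecRSet s a e1 e2 :
    exec (RSet a e1 e2) s
      (State (nmem s) (upd (rmem s) a (neval s e1) (reval s e2)))
      (ntime e1 + rtime e2).+1
| ExecSeq c1 c2 s1 s2 s3 t1 t2 :
    exec c1 s1 s2 t1 -> exec c2 s2 s3 t2 ->
    exec (Seq c1 c2) s1 s3 (t1 + t2)
| ExecIf b c1 c2 s s' t :
    exec (if beval s b then c1 else c2) s s' t ->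
    exec (If b c1 c2) s s' (btime b + t)
| ExecWhileDone b c s :
    ~~ beval s b -> exec (While b c) s s (btime b)
| ExecWhileLoop b c s1 s2 s3 t1 t2 :
    beval s1 b -> exec c s1 s2 t1 -> exec (While b c) s2 s3 t2 ->
    exec (While b c) s1 s3 (btime b + t1 + t2).

(* Programs are deterministic, so final state and time are functions of the
   initial state. *)
Lemma exec_det (R : realType) (c : cmd) (s s1 s2 : state R) (t1 t2 : nat) :
  exec c s s1 t1 -> exec c s s2 t2 -> s1 = s2 /\ t1 = t2.
Proof.
move=> E; elim: E s2 t2 => {c s s1 t1}.
- by move=> s s2 t2 E; inversion E.
- by move=> s a e1 e2 s2 t2 E; inversion E.
- by move=> s a e1 e2 s2 t2 E; inversion E.
- move=> c1 c2 s1 s2 s3 t1 t2 _ IH1 _ IH2 s4 t4 E.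
  inversion E as [| | | ? ? ? ? ? ? ? E1 E2 | | |]; subst.
  by case: (IH1 _ _ E1) => ? ?; subst; case: (IH2 _ _ E2) => ? ?; subst.
- move=> b c1 c2 s s' t _ IH s2 t2 E.
  inversion E as [| | | | ? ? ? ? ? ? E1 | |]; subst.
  by case: (IH _ _ E1) => ? ?; subst.
- move=> b c s nb s2 t2 E.
  inversion E as [| | | | | | ? ? ? ? ? ? ? hb E1 E2]; subst => //.
  by rewrite hb in nb.
- move=> b c s1 s2 s3 t1 t2 hb _ IH1 _ IH2 s4 t4 E.
  inversion E as [| | | | | ? ? ? nb | ? ? ? ? ? ? ? _ E1 E2]; subst.
    by rewrite hb in nb.
  by case: (IH1 _ _ E1) => ? ?; subst; case: (IH2 _ _ E2) => ? ?; subst.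
Qed.

(** * Input and output conventions *)

(* [f i] if [i] is a legal index, and [x0] otherwise. *)
Definition at_nat (T : Type) (n : nat) (x0 : T) (f : 'I_n -> T) (i : nat) : T :=
  if insub i is Some j then f j else x0.

Definition cmp_of_nat (i : nat) : option cmp :=
  nth None [:: Some CLt; Some CLe; Some CEq; Some CGe; Some CGt] i.

Definition cmp_code (o : cmp) : nat :=
  match o with CLt => 1 | CLe => 2 | CEq => 3 | CGe => 4 | CGt => 5 end.

(* An arbitrary set of reals is not a finite object.  What a program is told
   about the query set is, for each key, whether it is a query (array 1), and,
   for each gap, whether it contains a query (array 2).  The remaining input is
   n (array 0), the allowed operators (array 3), and the reals: keys, alpha and
   beta (real arrays 0, 1 and 2). *)
Definition input_state (R : realType) (n : nat) (I : instance R n) : state R :=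
  State
    (fun a i => match a with
     | 0 => if i == 0%N then n else 0%N
     | 1 => at_nat 0%N (fun j => nat_of_bool `[< queries I (key I j) >]) i
     | 2 => at_nat 0%N
              (fun j => nat_of_bool `[< gap I j `&` queries I !=set0 >]) i
     | 3 => if cmp_of_nat i is Some o then nat_of_bool (allowed I o) else 0%N
     | _ => 0%N
     end)
    (fun a i => match a with
     | 0 => at_nat 0 (key I) i
     | 1 => at_nat 0 (alpha I) i
     | 2 => at_nat 0 (beta I) i
     | _ => 0
     end).

(* Preorder listing: 0 for a leaf; operator code, key index, yes subtree, no
   subtree for an internal node. *)
Fixpoint encode (n : nat) (T : tree n) : seq nat :=
  match T with
  | Leaf => [:: 0%N]
  | Node o i y z => [:: cmp_code o, nat_of_ord i & encode y ++ encode z]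
  end.

(* The output is left in array 5, its length in cell 0 of array 4. *)
Definition output (R : realType) (s : state R) : seq nat :=
  mkseq (nmem s 5) (nmem s 4 0).

(* With some query sets and operator sets there is no correct tree at all; the
   empty output reports this. *)
Definition optimal_output (R : realType) (n : nat) (I : instance R n)
    (P : probability (measurableTypeR R) R) (out : seq nat) : Prop :=
  ((exists T : tree n, correct I T) ->
     exists T : tree n, optimal I P T /\ out = encode T) /\
  (~ (exists T : tree n, correct I T) -> out = [::]).

(* Main.v *)
Require Import Defs.
From mathcomp Require Import all_boot all_order all_algebra.
From mathcomp Require Import all_classical all_reals all_analysis.
From mathcomp Require Import measurable_realfun zify lra.

(* Order the keys by decreasing probability.  If the root of a tree tests
   equality with a key [H] although a likelier key [K] is still possible, then
   some tree of no larger cost has at its root an equality test with [K] or an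
   inequality test that separates [H] and [K].  So, as long as equality tests
   are made at all, the next one may be assumed to concern the likeliest key
   left, and every subproblem consists of an interval of keys and gaps from
   which the keys of rank below some [r] have been removed.  There are O(n^3) of
   them, each solved in time O(n) from smaller ones. *)

Set Implicit Arguments.
Unset Strict Implicit.
Unset Printing Implicit Defensive.

Import Order.TTheory GRing.Theory Num.Theory.
Local Open Scope ring_scope.

(** * Trading equality tests *)

(** Keys and gaps form 2n+1 positions along the line, and a search depends on a query only through
    its position; query set, law and tree thus become finite data. Two features of the problem shape
    the argument. The operator set is arbitrary, so a subproblem may have no correct tree at all,
    and the table must record feasibility beside cost. A class of probability 0 that contains
    queries must still be told apart from the others, so leaves are judged by the positions that
    occur among the queries, not by weight. The trade is free of cost because a cut separating [H]
    and [K] leaves out, on either side, a key at least as heavy as [H]: neither side weighs more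
    than the set with [H] removed. Tests pushed below such a cut are therefore charged no more than
    before. The time O(n) per subproblem pays both for summing its weight anew and for trying all
    cuts. Two limits of the machine have to be worked around: without multiplication, table
    addresses come from precomputed multiples; without recursion, the tree is written out with an
    explicit stack. *)

Definition ptest (o : cmp) (p k : nat) : bool :=
  match o with
  | CLt => (p < k)%N
  | CLe => (p <= k)%N
  | CEq => (p == k)%N
  | CGe => (p >= k)%N
  | CGt => (p > k)%N
  end.

(* Position [2 * i] is the gap below key [i], position [keypos i] the key itself. *)
Definition keypos (i : nat) : nat := (i + i).+1.

Lemma odd_keypos i : odd (keypos i).
Proof. by rewrite /keypos oddS addnn odd_double. Qed.

(* An odd [c] separates a key from the gap below it, an even one from the gap
   above it; the value is the code of an allowed operator that does it, or 0. *)
Definition cut_op (C : pred cmp) (c : nat) : nat :=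
  if odd c then (if C CLt then 1 else if C CGe then 4 else 0)%N
  else (if C CLe then 2 else if C CGt then 5 else 0)%N.

(* Comparison trees up to the orientation of inequality tests; the yes-branch
   of an equality test, where nothing is left to decide, is omitted. *)
Inductive ctree :=
| CLeaf
| CEqual of nat & ctree
| CCut of nat & ctree & ctree.

Section Positions.
Variables (R : realDomainType) (n : nat) (C : pred cmp) (w : nat -> R).
Hypothesis w_ge0 : forall p, 0 <= w p.

Implicit Types (S : pred nat).

Definition below S m : pred nat := fun p => S p && (p < m)%N.
Definition above S m : pred nat := fun p => S p && (m <= p)%N.
Definition without S k : pred nat := fun p => S p && (p != k).

Definition wt S : R := \sum_(p < (n + n).+1 | S p) w p.

Definition subsing S := forall p q, S p -> S q -> p = q.

(** Correctness seen from the set [S] of positions that reach the root; narrowing [S] along a path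
    replaces the comparison of answer sequences. *)
Fixpoint pvalid S (T : tree n) : Prop :=
  match T with
  | Leaf => subsing S
  | Node o i y z =>
      [/\ C o, pvalid (fun p => S p && ptest o p (keypos i)) y
        & pvalid (fun p => S p && ~~ ptest o p (keypos i)) z]
  end.

Fixpoint pcost S (T : tree n) : R :=
  match T with
  | Leaf => 0
  | Node o i y z =>
      wt S + pcost (fun p => S p && ptest o p (keypos i)) y
      + pcost (fun p => S p && ~~ ptest o p (keypos i)) z
  end.

Fixpoint cvalid S (t : ctree) : Prop :=
  match t with
  | CLeaf => subsing S
  | CEqual i z => [/\ C CEq, (i < n)%N & cvalid (without S (keypos i)) z]
  | CCut c l r =>
      [/\ (0 < c <= n + n)%N, cut_op C c != 0%N, cvalid (below S c) l
        & cvalid (above S c) r]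
  end.

Fixpoint ccost S (t : ctree) : R :=
  match t with
  | CLeaf => 0
  | CEqual i z => wt S + ccost (without S (keypos i)) z
  | CCut c l r => wt S + ccost (below S c) l + ccost (above S c) r
  end.

Lemma wt_ge0 S : 0 <= wt S.
Proof. exact: sumr_ge0. Qed.

Lemma wt_subset S S' : (forall p, S p -> S' p) -> wt S <= wt S'.
Proof.
move=> sub; rewrite /wt [leRHS]big_mkcond [leLHS]big_mkcond.
apply: ler_sum => p _; have := sub p.
by case: (S p) => [->|_] //; case: (S' p).
Qed.

Lemma wt_cut S m : wt S = wt (below S m) + wt (above S m).
Proof.
rewrite /wt (bigID (fun p : 'I__ => (p < m)%N)) /=; congr (_ + _).
by apply: eq_bigl => p; rewrite /above -leqNgt.
Qed.

Lemma wt_without S k : (k <= n + n)%N -> S k -> wt S = w k + wt (without S k).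
Proof.
move=> kn Sk; rewrite /wt (bigD1 (Ordinal (kn : (k < (n + n).+1)%N))) //=.
Qed.

Lemma le_wt S k : (k <= n + n)%N -> S k -> w k <= wt S.
Proof. by move=> kn Sk; rewrite (wt_without kn Sk) lerDl wt_ge0. Qed.

Lemma ccost_ge0 S t : 0 <= ccost S t.
Proof.
elim: t S => [|i z IHz|c l IHl r IHr] S //=; first by rewrite addr_ge0 ?wt_ge0.
by rewrite !addr_ge0 ?wt_ge0.
Qed.

(** Together with the monotonicity of cost, this lets a subtree replace its parent when the test at
    the parent excludes nothing. *)
Lemma cvalid_subset S S' t :
  (forall p, S' p -> S p) -> cvalid S t -> cvalid S' t.
Proof.
elim: t S S' => [|i z IHz|c l IHl r IHr] S S' sub /=.
- by move=> h p q /sub + /sub; apply: h.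
- case=> Ce ilt vz; split=> //; apply: IHz vz => p.
  by move=> /andP[/sub Sp pi]; apply/andP.
- case=> cn opc vl vr; split=> //.
    by apply: IHl vl => p /andP[/sub Sp pi]; apply/andP.
  by apply: IHr vr => p /andP[/sub Sp pi]; apply/andP.
Qed.

Lemma ccost_subset S S' t :
  (forall p, S' p -> S p) -> ccost S' t <= ccost S t.
Proof.
elim: t S S' => [|i z IHz|c l IHl r IHr] S S' sub //=.
- apply: lerD; first exact: wt_subset.
  by apply: IHz => p /andP[/sub Sp pi]; apply/andP.
- apply: lerD; [apply: lerD; first exact: wt_subset; apply: IHl|apply: IHr];
    by move=> p /andP[/sub Sp pi]; apply/andP.
Qed.

Lemma below_without S m k :
  below (without S k) m = without (below S m) k.
Proof. by apply/funext => p; rewrite /below /without andbAC. Qed.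

Lemma above_without S m k :
  above (without S k) m = without (above S m) k.
Proof. by apply/funext => p; rewrite /above /without andbAC. Qed.

Lemma withoutC S k l : without (without S k) l = without (without S l) k.
Proof. by apply/funext => p; rewrite /without andbAC. Qed.

Lemma without_id S k : S k = false -> without S k = S.
Proof.
move=> Sk; apply/funext => p; rewrite /without.
by case: eqP => [->|_]; rewrite ?Sk ?andbT.
Qed.

Lemma below_above S m k : below (above S k) m = above (below S m) k.
Proof. by apply/funext => p; rewrite /below /above andbAC. Qed.

Lemma below_below S m k : (k <= m)%N -> below (below S m) k = below S k.
Proof. by move=> km; apply/funext => p; rewrite /below; case: (S p) => //=; lia. Qed.

Lemma above_above S m k : (k <= m)%N -> above (above S k) m = above S m.
Proof. by move=> km; apply/funext => p; rewrite /above; case: (S p) => //=; lia. Qed.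

(* The side that is left out contains a key at least as heavy as [H]. *)
Lemma cut_side S H K m : (H <= n + n)%N -> (K <= n + n)%N -> S H -> S K ->
  w H <= w K -> (minn H K < m <= maxn H K)%N ->
  wt (below S m) <= wt (without S H) /\ wt (above S m) <= wt (without S H).
Proof.
move=> Hn Kn SH SK wHK /andP[m1 m2].
have E1 := wt_without Hn SH; have E2 := wt_cut S m.
have B k : (k <= n + n)%N -> S k -> (k < m)%N -> w k <= wt (below S m).
  by move=> kn Sk km; apply: le_wt => //; rewrite /below Sk.
have D k : (k <= n + n)%N -> S k -> (m <= k)%N -> w k <= wt (above S m).
  by move=> kn Sk km; apply: le_wt => //; rewrite /above Sk.
case: (ltnP H m) => Hm.
  have Km : (m <= K)%N by lia.
  by have := B _ Hn SH Hm; have := D _ Kn SK Km; lra.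
have Km : (K < m)%N by lia.
by have := D _ Hn SH Hm; have := B _ Kn SK Km; lra.
Qed.

(* An equality test for a light key [H] at the root can be traded, at no cost,
   for a test of the heavier key [K] or for a cut separating the two: the tests
   on the path of [K] are pushed below the one that replaces it. *)
Lemma exchange S H K z : (H < n)%N -> (K < n)%N -> C CEq ->
  S (keypos H) -> S (keypos K) -> H <> K -> w (keypos H) <= w (keypos K) ->
  cvalid (without S (keypos H)) z ->
  (exists2 z', cvalid (without S (keypos K)) z' &
     ccost (without S (keypos K)) z' <= ccost (without S (keypos H)) z) \/
  (exists m l r, [/\ (minn (keypos H) (keypos K) < m <= maxn (keypos H) (keypos K))%N,
     cvalid S (CCut m l r) &
     ccost (below S m) l + ccost (above S m) r <= ccost (without S (keypos H)) z]).
Proof.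
move=> Hn Kn Ce SH SK HK wHK.
set h := keypos H in SH wHK *; set k := keypos K in SK wHK *.
have hn : (h <= n + n)%N by rewrite /h /keypos; lia.
have kn : (k <= n + n)%N by rewrite /k /keypos; lia.
have hk : h != k by rewrite /h /k /keypos; lia.
have kh : k != h by rewrite eq_sym.
have wKH S1 : S1 h -> S1 k -> wt (without S1 k) <= wt (without S1 h).
  by move=> h1 h2; have := wt_without hn h1; have := wt_without kn h2; lra.
(* [S] stays general: each case lifts a replacement found for a subtree, on a smaller set, through
   one more test. *)
elim: z S SH SK => [|X z IHz|x l IHl r IHr] S SH SK.
(* Here [S] is exactly {h, k}, so once [K] is tested only [h] is left and a leaf suffices again. *)
- move=> /= sg; left; exists CLeaf => //= p q.
  have key p' : without S k p' -> p' = h.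
    rewrite /without => /andP[Sp pk].
    have [-> //|ph] := eqVneq p' h.
    have := sg p' k; rewrite /without Sp SK ph kh => /(_ isT isT) pk'.
    by rewrite pk' eqxx in pk.
  by move=> /key -> /key ->.
- move=> /= [_ Xn vz].
  have Xnn : (keypos X <= n + n)%N by rewrite /keypos; lia.
  (* A repeated test of [H] is void and is dropped. *)
  have [XH|XH] := eqVneq X H.
    rewrite XH -/h in vz *.
    have E : without (without S h) h = without S h.
      by rewrite without_id // /without eqxx andbF.
    rewrite E in vz *.
    have [[z' vz' cz']|[m [l [r [mm vv cc]]]]] := IHz S SH SK vz.
      left; exists z' => //; apply: le_trans cz' _.
      by rewrite lerDr wt_ge0.
    right; exists m, l, r; split => //.
    by apply: le_trans cc _; rewrite lerDr wt_ge0.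
  (* The two equality tests change places; the lower one is then charged the set without [K], which
     is no heavier than the set without [H]. *)
  have [XK|XK] := eqVneq X K.
    rewrite XK -/k in vz *; left; exists (CEqual H z) => /=; rewrite -/h withoutC.
      by split.
    by rewrite lerD2r wKH.
  have xh : h != keypos X by rewrite /h /keypos; lia.
  have xk : k != keypos X by rewrite /k /keypos; lia.
  rewrite [X in cvalid X z]withoutC in vz; rewrite [X in ccost X z]withoutC.
  have [||[z' vz' cz']|[m [l [r [mm /= [mn opm vl vr] cc]]]]] := IHz (without S (keypos X)) _ _ vz.
  + by rewrite /without SH.
  + by rewrite /without SK.
  + left; exists (CEqual X z') => /=; rewrite withoutC; first by split.
    by apply: lerD => //; apply: wKH.
  (* The cut at [m] rises above the test of [X], which moves to the side that can contain [X] and is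
     charged only the weight of that side. *)
  have [cs1 cs2] := cut_side hn kn SH SK wHK mm.
  rewrite below_without above_without in vl vr cc.
  right; case: (ltnP (keypos X) m) => Xm.
    have E : without (above S m) (keypos X) = above S m.
      by rewrite without_id // /above leqNgt Xm andbF.
    rewrite E in vr cc; exists m, (CEqual X l), r; split=> //=; lra.
  have E : without (below S m) (keypos X) = below S m.
    by rewrite without_id // /below ltnNge Xm andbF.
  rewrite E in vl cc; exists m, l, (CEqual X r); split=> //=; lra.
- move=> /= [xn opx vl vr].
  rewrite below_without above_without in vl vr *.
  (* If [x] already separates the two keys, it becomes the root, and the test of [H] goes to the
     side of [H]. *)
  have [xm|xm] := boolP (minn h k < x <= maxn h k)%N.
    have [cs1 cs2] := cut_side hn kn SH SK wHK xm.
    right; case: (ltnP h x) => hx.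
      have E : without (above S x) h = above S x.
        by rewrite without_id // /above leqNgt hx andbF.
      rewrite E in vr *; exists x, (CEqual H l), r; split=> //=; rewrite -/h; lra.
    have E : without (below S x) h = below S x.
      by rewrite without_id // /below ltnNge hx andbF.
    rewrite E in vl *; exists x, l, (CEqual H r); split=> //=; rewrite -/h; lra.
  (* Otherwise both keys lie on one side of [x]. Either that side is replaced in place, or a cut [m]
     found in it changes places with [x]. *)
  case: (leqP x (minn h k)) => xlow.
    have E g : (x <= g)%N -> without (below S x) g = below S x.
      by move=> xg; rewrite without_id // /below ltnNge xg andbF.
    have xh : (x <= h)%N by lia.
    have xk : (x <= k)%N by lia.
    rewrite E // in vl *.
    have [||[z' vz' cz']|[m [l' [r' [mm /= [mn opm vl' vr'] cc]]]]] := IHr (above S x) _ _ vr.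
    + by rewrite /above SH.
    + by rewrite /above SK.
    + left; exists (CCut x l z') => /=; rewrite below_without above_without E //.
      by apply: lerD => //; apply: lerD => //; apply: wKH.
    have [cs1 cs2] := cut_side hn kn SH SK wHK mm.
    have xm' : (x <= m)%N by lia.
    rewrite above_above // below_above in vl' vr' cc.
    right; exists m, (CCut x l l'), r'; split=> //=.
      by split=> //; split=> //; rewrite below_below.
    rewrite below_below //; lra.
  have E g : (g < x)%N -> without (above S x) g = above S x.
    by move=> xg; rewrite without_id // /above leqNgt xg andbF.
  have xh : (h < x)%N by lia.
  have xk : (k < x)%N by lia.
  rewrite E // in vr *.
  have [||[z' vz' cz']|[m [l' [r' [mm /= [mn opm vl' vr'] cc]]]]] := IHl (below S x) _ _ vl.
  + by rewrite /below SH.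
  + by rewrite /below SK.
  + left; exists (CCut x z' r) => /=; rewrite below_without above_without E //.
    by rewrite lerD2r; apply: lerD => //; apply: wKH.
  have [cs1 cs2] := cut_side hn kn SH SK wHK mm.
  have xm' : (m <= x)%N by lia.
  rewrite below_below // -below_above in vl' vr' cc.
  right; exists m, l', (CCut x r' r); split=> //=.
    by split=> //; split=> //; rewrite above_above.
  rewrite above_above //; lra.
Qed.

(** Inequality tests become cuts, with the children swapped for [CGe] and [CGt]. Dropping the
    yes-branch of an equality test can only lower the cost, since costs are nonnegative. *)
Lemma ctree_of_tree S (T : tree n) : pvalid S T ->
  exists2 t, cvalid S t & ccost S t <= pcost S T.
Proof.
have cutP c S1 y z ty tz : (0 < c <= n + n)%N -> cut_op C c != 0%N ->
    cvalid (below S1 c) ty -> cvalid (above S1 c) tz ->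
    ccost (below S1 c) ty <= y -> ccost (above S1 c) tz <= z ->
    exists2 t, cvalid S1 t & ccost S1 t <= wt S1 + y + z.
  move=> cn opc vy vz cy cz; exists (CCut c ty tz) => /=; first by split.
  by apply: lerD => //; rewrite lerD2l.
have evenk i : odd (keypos i).+1 = false by rewrite oddS odd_keypos.
elim: T S => [|o i y IHy z IHz] S; first by exists CLeaf.
have in_ : (i < n)%N := ltn_ord i.
case: o => /= -[Co] /IHy[ty vy cy] /IHz[tz vz cz].
- apply: (cutP (keypos i) _ _ _ ty tz); rewrite /cut_op ?odd_keypos ?Co //.
  + by rewrite /keypos; lia.
  + by have -> : above S (keypos i) = (fun p => S p && ~~ (p < keypos i)%N)
      by apply/funext => p; rewrite -leqNgt.
  + by have -> : above S (keypos i) = (fun p => S p && ~~ (p < keypos i)%N)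
      by apply/funext => p; rewrite -leqNgt.
- apply: (cutP (keypos i).+1 _ _ _ ty tz); rewrite /cut_op ?evenk ?Co //.
  + by rewrite /keypos; lia.
  + by have -> : above S (keypos i).+1 = (fun p => S p && ~~ (p <= keypos i)%N)
      by apply/funext => p; rewrite -ltnNge.
  + by have -> : above S (keypos i).+1 = (fun p => S p && ~~ (p <= keypos i)%N)
      by apply/funext => p; rewrite -ltnNge.
- exists (CEqual i tz) => //=; rewrite -addrA lerD2l.
  by apply: le_trans cz _; rewrite lerDr; apply: le_trans cy; apply: ccost_ge0.
- rewrite addrAC; apply: (cutP (keypos i) _ _ _ tz ty); rewrite /cut_op ?odd_keypos ?Co //.
  + by rewrite /keypos; lia.
  + by case: (C CLt).
  + by have -> : below S (keypos i) = (fun p => S p && ~~ (keypos i <= p)%N)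
      by apply/funext => p; rewrite -ltnNge.
  + by have -> : below S (keypos i) = (fun p => S p && ~~ (keypos i <= p)%N)
      by apply/funext => p; rewrite -ltnNge.
- rewrite addrAC; apply: (cutP (keypos i).+1 _ _ _ tz ty); rewrite /cut_op ?evenk ?Co //.
  + by rewrite /keypos; lia.
  + by case: (C CLe).
  + by have -> : below S (keypos i).+1 = (fun p => S p && ~~ (keypos i < p)%N)
      by apply/funext => p; rewrite -leqNgt.
  + by have -> : below S (keypos i).+1 = (fun p => S p && ~~ (keypos i < p)%N)
      by apply/funext => p; rewrite -leqNgt.
Qed.

(** * Subproblems, their recurrence and its soundness *)

Variables (pr : pred nat) (rk ord : nat -> nat).
Hypothesis ordP : forall r, (r < n)%N -> (ord r < n)%N /\
  forall p, (p <= n + n)%N -> (rk p == r) = (p == keypos (ord r)).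
Hypothesis rk_lt : forall i, (i < n)%N -> (rk (keypos i) < n)%N.
Hypothesis rk_wt : forall i j, (i < n)%N -> (j < n)%N ->
  (rk (keypos i) <= rk (keypos j))%N -> w (keypos j) <= w (keypos i).

(* Gaps have rank at least [n], hence are never removed. *)
Definition sub a b r : pred nat :=
  fun p => [&& (a <= p)%N, (p < b)%N, pr p & (r <= rk p)%N].

Variables (ch : nat -> nat -> nat -> nat) (F : nat -> nat -> nat -> R).

(* Code of a choice: 1 for a leaf, 2 when the key of rank [r] is missing from
   the subproblem, 3 for an equality test of that key, [3 + c] for a cut at
   [c]; code 0 is kept for infeasible subproblems. *)
Variant choice_value a b r : nat -> R -> Prop :=
| ChooseLeaf : subsing (sub a b r) -> choice_value a b r 1 0
| ChooseSkip : ~ subsing (sub a b r) -> (r < n)%N ->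
    ~~ sub a b r (keypos (ord r)) -> ch r.+1 a b != 0%N ->
    choice_value a b r 2 (F r.+1 a b)
| ChooseEqual : ~ subsing (sub a b r) -> (r < n)%N ->
    sub a b r (keypos (ord r)) -> C CEq -> ch r.+1 a b != 0%N ->
    choice_value a b r 3 (wt (sub a b r) + F r.+1 a b)
| ChooseCut c : ~ subsing (sub a b r) -> (a < c < b)%N -> cut_op C c != 0%N ->
    ch r a c != 0%N -> ch r c b != 0%N ->
    choice_value a b r (3 + c)%N (wt (sub a b r) + F r a c + F r c b).

(** A local condition: the entry is best among the choices built from the other entries, whatever
    these contain. That it forces global optimality is the content of [traced_ok] and
    [table_lower_bound]. *)
Definition cell_ok a b r : Prop :=
  (ch r a b = 0%N -> forall x v, ~ choice_value a b r x v) /\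
  (ch r a b != 0%N -> choice_value a b r (ch r a b) (F r a b) /\
     forall x v, choice_value a b r x v -> F r a b <= v).

(* [traced r a b T k]: the tree read off the choices is [T], and reading it
   takes [k] steps. *)
Inductive traced : nat -> nat -> nat -> tree n -> nat -> Prop :=
| TracedLeaf r a b : ch r a b = 1%N -> traced r a b Leaf 1
| TracedSkip r a b T k : (r < n)%N -> ch r a b = 2%N -> traced r.+1 a b T k ->
    traced r a b T k.+1
| TracedEqual r a b (i : 'I_n) T k : (r < n)%N -> ch r a b = 3%N -> ord r = i ->
    traced r.+1 a b T k -> traced r a b (Node CEq i Leaf T) k.+1
| TracedCut r a b (c : nat) o (i : 'I_n) T U k l :
    ch r a b = (3 + c)%N -> (a < c < b)%N -> cut_op C c = cmp_code o ->
    c.-1./2 = i ->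
    traced r a c T k -> traced r c b U l ->
    traced r a b (if (cut_op C c < 3)%N then Node o i T U else Node o i U T)
      (k + l).+1.

Lemma below_sub a b r c : (c <= b)%N -> below (sub a b r) c = sub a c r.
Proof.
move=> cb; apply/funext => p; rewrite /below /sub.
by case: (pr p); rewrite ?andbF //=; case: (r <= rk p)%N; rewrite ?andbF //; lia.
Qed.

Lemma above_sub a b r c : (a <= c)%N -> above (sub a b r) c = sub c b r.
Proof.
move=> ac; apply/funext => p; rewrite /above /sub.
by case: (pr p); rewrite ?andbF //=; case: (r <= rk p)%N; rewrite ?andbF //; lia.
Qed.

Lemma without_sub a b r : (b <= (n + n).+1)%N -> (r < n)%N ->
  without (sub a b r) (keypos (ord r)) = sub a b r.+1.
Proof.
move=> bn rn; apply/funext => p; rewrite /without /sub.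
have [_ /(_ p)] := ordP rn.
case: (ltnP p b) => [pb|_]; last by rewrite /= !andbF.
move=> <-; last lia.
by rewrite [(r < _)%N]ltn_neqAle eq_sym; case: (_ == _); rewrite ?andbT ?andbF.
Qed.

(** Reads operator and key back from a cut: [c] is 2i+1 or 2i+2, and in both cases [c.-1./2] is
    i. *)
Lemma cut_opP c : (0 < c <= n + n)%N -> cut_op C c != 0%N ->
  exists o (i : 'I_n), [/\ cut_op C c = cmp_code o, c.-1./2 = i, C o &
    forall p, ptest o p (keypos i) = if (cut_op C c < 3)%N then (p < c)%N else (c <= p)%N].
Proof.
move=> cn opc.
have i_lt : (c.-1./2 < n)%N by lia.
have E := odd_double_half c.-1.
move: opc; rewrite /cut_op; case: ifP => oc.
  have ec : keypos (c.-1./2) = c.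
    by rewrite /keypos; move: oc E; case: (c) cn => //= d _ /negbTE ->; lia.
  case: (boolP (C CLt)) => [h _|_].
    by exists CLt, (Ordinal i_lt); rewrite /= ec.
  case: (boolP (C CGe)) => [h _|//].
  by exists CGe, (Ordinal i_lt); rewrite /= ec.
have ec : (keypos (c.-1./2)).+1 = c.
  by rewrite /keypos; move: oc E; case: (c) cn => //= d _ /negbFE ->; lia.
case: (boolP (C CLe)) => [h _|_].
  by exists CLe, (Ordinal i_lt); split=> //= p; rewrite -[in RHS]ec ltnS.
case: (boolP (C CGt)) => [h _|//].
by exists CGt, (Ordinal i_lt); split=> //= p; rewrite -[in RHS]ec.
Qed.

(** A skip or an equality test raises [r], and a cut splits the interval, so unfolding the choices
    ends. In the bound on steps, raising [r] lowers the second factor by one; at a cut the bounds of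
    the two parts add up, and their strictness leaves room for the cut itself. *)
Lemma traced_ok : (forall a b r, (a < b <= (n + n).+1)%N -> (r <= n)%N -> cell_ok a b r) ->
  forall a b r, (a < b <= (n + n).+1)%N -> (r <= n)%N -> ch r a b != 0%N ->
  exists T k, [/\ traced r a b T k, pvalid (sub a b r) T,
    pcost (sub a b r) T = F r a b & (k < (b - a) * (n - r).+2)%N].
Proof.
move=> ok a b r; have [m] := ubnP ((n - r) + (b - a))%N.
elim: m a b r => // m IH a b r lem abn rn chn0.
have [_ /(_ chn0)[cv _]] := ok _ _ _ abn rn.
move E1: (ch r a b) cv => x; move E2: (F r a b) => v cv.
case: cv E1 E2 => [sg|nsg rn' kS ch1|nsg rn' kS Ce ch1|c nsg abc opc chl chr] E1 E2.
- exists Leaf, 1%N; split=> //; first exact: TracedLeaf.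
  have : (0 < b - a)%N by lia.
  case: (b - a)%N => // d _; rewrite mulSn; lia.
- have [|T [k [tr vT cT kT]]] := IH a b r.+1 _ abn rn' ch1; try lia.
  have E : sub a b r.+1 = sub a b r.
    by rewrite -without_sub ?without_id //; [apply/negbTE|lia].
  rewrite E in vT cT; exists T, k.+1; split=> //; first exact: TracedSkip.
  have -> : (n - r = (n - r.+1).+1)%N by lia.
  rewrite [X in (_ < X)%N]mulnS; lia.
- have [|T [k [tr vT cT kT]]] := IH a b r.+1 _ abn rn' ch1; try lia.
  have [on _] := ordP rn'.
  have bn : (b <= (n + n).+1)%N by lia.
  exists (Node CEq (Ordinal on) Leaf T), k.+1.
  have E : (fun p => sub a b r p && (p != keypos (ord r))) = sub a b r.+1.
    by rewrite -without_sub.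
  split=> //=; first exact: TracedEqual.
  + split=> //; last by rewrite E.
    by move=> p q /andP[_ /eqP ->] /andP[_ /eqP ->].
  + by rewrite E cT addr0.
  + have -> : (n - r = (n - r.+1).+1)%N by lia.
    rewrite [X in (_ < X)%N]mulnS; lia.
- have [||T [k [trT vT cT kT]]] := IH a c r _ _ rn chl; try lia.
  have [||U [l [trU vU cU lU]]] := IH c b r _ _ rn chr; try lia.
  have [|o [i [oc ic Co tst]]] := @cut_opP c _ opc; try lia.
  have bE : (fun p => sub a b r p && (p < c)%N) = sub a c r.
    by apply: (@below_sub a b r c); lia.
  have aE : (fun p => sub a b r p && (c <= p)%N) = sub c b r.
    by apply: (@above_sub a b r c); lia.
  exists (if (cut_op C c < 3)%N then Node o i T U else Node o i U T), (k + l).+1.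
  have tr : traced r a b (if (cut_op C c < 3)%N then Node o i T U else Node o i U T) (k + l).+1.
    by apply: TracedCut trT trU => //; lia.
  have kl : ((k + l).+1 < (b - a) * (n - r).+2)%N.
    have -> : (b - a = (c - a) + (b - c))%N by lia.
    rewrite mulnDl; lia.
  case: ifP tst tr => _ tst tr.
    have e1 : (fun p => sub a b r p && ptest o p (keypos i)) = sub a c r.
      by rewrite -bE; apply/funext => p; rewrite tst.
    have e2 : (fun p => sub a b r p && ~~ ptest o p (keypos i)) = sub c b r.
      by rewrite -aE; apply/funext => p; rewrite tst -leqNgt.
    by split=> //=; rewrite e1 e2 ?cT ?cU.
  have e1 : (fun p => sub a b r p && ptest o p (keypos i)) = sub c b r.
    by rewrite -aE; apply/funext => p; rewrite tst.
  have e2 : (fun p => sub a b r p && ~~ ptest o p (keypos i)) = sub a c r.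
    by rewrite -bE; apply/funext => p; rewrite tst -ltnNge.
  by split=> //=; rewrite e1 e2 ?cT ?cU // addrAC.
Qed.

(** Outer induction on the size of the subproblem: whatever root a competing tree has, it can be
    brought to the form of one of the listed choices, whose parts are bounded below by smaller
    entries. *)
Lemma table_lower_bound :
  (forall a b r, (a < b <= (n + n).+1)%N -> (r <= n)%N -> cell_ok a b r) ->
  forall a b r t, (a < b <= (n + n).+1)%N -> (r <= n)%N ->
  cvalid (sub a b r) t -> ch r a b != 0%N /\ F r a b <= ccost (sub a b r) t.
Proof.
move=> ok a b r; have [m] := ubnP ((n - r) + (b - a))%N.
elim: m a b r => // m IH a b r lem t abn rn.
have [ok1 ok2] := ok _ _ _ abn rn.
have by_choice x v y : choice_value a b r x v -> v <= y ->
    ch r a b != 0%N /\ F r a b <= y.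
  move=> cv vy; have chn0 : ch r a b != 0%N.
    by apply/negP => /eqP /ok1 /(_ _ _ cv).
  by have [_ /(_ _ _ cv) h] := ok2 chn0; split=> //; apply: le_trans vy.
case: (pselect (subsing (sub a b r))) => [sg _|nsg].
  by apply: (by_choice 1%N 0); [exact: ChooseLeaf|exact: ccost_ge0].
have bn : (b <= (n + n).+1)%N by lia.
have by_cut c l u : (a < c < b)%N -> cvalid (sub a b r) (CCut c l u) ->
    ch r a b != 0%N /\
    F r a b <= wt (sub a b r) + (ccost (below (sub a b r) c) l + ccost (above (sub a b r) c) u).
  move=> acb /= [cn opc].
  rewrite below_sub ?above_sub; try lia.
  move=> vl vu.
  have [||ch1 F1] := IH a c r _ l _ rn vl; try lia.
  have [||ch2 F2] := IH c b r _ u _ rn vu; try lia.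
  apply: by_choice; first exact: ChooseCut opc ch1 ch2.
  by rewrite -addrA lerD2l lerD.
(* When the key of rank [r] is missing, raising [r] leaves the set unchanged, and the same tree is
   handled by the outer induction. *)
case: (pselect ((r < n)%N /\ ~~ sub a b r (keypos (ord r)))) => [[rn' kS]|skip].
  have E : sub a b r.+1 = sub a b r.
    by rewrite -without_sub ?without_id //; apply/negbTE.
  rewrite -{1}E => vt; have [|ch1 F1] := IH a b r.+1 _ t abn rn' vt; try lia.
  by apply: by_choice; [exact: ChooseSkip|rewrite -E].
have by_equal z : (r < n)%N -> C CEq ->
    cvalid (without (sub a b r) (keypos (ord r))) z -> ch r a b != 0%N /\
    F r a b <= wt (sub a b r) + ccost (without (sub a b r) (keypos (ord r))) z.
  move=> rn' Ce; rewrite without_sub // => vz.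
  have [|ch1 F1] := IH a b r.+1 _ z abn rn' vz; try lia.
  apply: by_choice; first by apply: ChooseEqual ch1 => //; apply/negPn/negP => ?; case: skip.
  by rewrite lerD2l.
(* For a root test that excludes nothing from the subproblem: [t1] is the branch everything takes,
   [S'] the set reaching it, [y] the cost of the other branch. *)
have drop t1 S' y : (forall p, sub a b r p -> S' p) ->
    (cvalid (sub a b r) t1 -> ch r a b != 0%N /\ F r a b <= ccost (sub a b r) t1) ->
    cvalid S' t1 -> 0 <= y ->
    ch r a b != 0%N /\ F r a b <= wt (sub a b r) + y + ccost S' t1.
  move=> sub1 h v1 y0; have [h1 h2] := h (cvalid_subset sub1 v1).
  split=> //; apply: le_trans h2 _; apply: le_trans (ccost_subset t1 sub1) _.
  by rewrite lerDr addr_ge0 ?wt_ge0.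
(* The inner induction serves only void root tests; all others are settled by smaller
   subproblems. *)
elim: t => [|i z IHz|c l IHl u IHu]; first by [].
  move=> /= [Ce in_ vz].
  have kin : (keypos i <= n + n)%N by rewrite /keypos; lia.
  have [Si|Si] := boolP (sub a b r (keypos i)); last first.
    by rewrite -[wt _]addr0; apply: drop IHz vz _ => // p Sp;
      rewrite /without Sp; apply/eqP => pi; rewrite pi (negbTE Si) in Sp.
  have rn' : (r < n)%N.
    by case/and4P: Si => _ _ _ h; apply: leq_ltn_trans h (rk_lt in_).
  have [on rkE] := ordP rn'.
  have Sk : sub a b r (keypos (ord r)).
    by apply/negPn/negP => ?; case: skip.
  have [io|io] := eqVneq i (ord r); first by rewrite io in vz *; apply: by_equal.
  have rko : rk (keypos (ord r)) = r by apply/eqP; rewrite rkE // /keypos; lia.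
  have wle : w (keypos i) <= w (keypos (ord r)).
    by apply: rk_wt => //; rewrite rko; case/and4P: Si.
  (* A key other than the likeliest one left is tested. The trade gives a test of the key of rank
     [r], or a cut between two members of the subproblem and hence inside its interval. *)
  have [[z' vz' cz']|[c [l [u [cc vc le]]]]] :=
      exchange in_ on Ce Si Sk (elimN eqP io) wle vz.
    have [h1 h2] := by_equal z' rn' Ce vz'.
    by split=> //; apply: le_trans h2 _; rewrite lerD2l.
  have [|h1 h2] := by_cut c l u _ vc.
    by move: Si Sk => /and4P[? ? _ _] /and4P[? ? _ _]; lia.
  by split=> //; apply: le_trans h2 _; rewrite lerD2l.
move=> vt; have /= [cn opc vl vu] := vt.
case: (leqP c a) => ca.
  by apply: drop IHu vu (ccost_ge0 _ _) => p Sp; rewrite /above Sp;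
    case/and4P: Sp => ? ? _ _; lia.
case: (leqP b c) => cb.
  by rewrite addrAC; apply: drop IHl vl (ccost_ge0 _ _) => p Sp; rewrite /below Sp;
    case/and4P: Sp => ? ? _ _; lia.
by rewrite -addrA; apply: by_cut => //; rewrite ca.
Qed.

End Positions.

(** Choices for an entry read only entries with a subinterval and a rank bound at least as large,
    and never the entry itself. This is what fixes the possible orders of filling the table. *)
Lemma choice_value_ext (R : realDomainType) n (C : pred cmp) (w : nat -> R)
    pr rk ord ch F ch' F' a b r x v : (a < b)%N -> (r <= n)%N ->
  (forall a' b' r', (a <= a')%N -> (b' <= b)%N -> (a' < b')%N ->
     (r <= r' <= n)%N -> (r, a, b) != (r', a', b') ->
     ch' r' a' b' = ch r' a' b' /\ F' r' a' b' = F r' a' b') ->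
  choice_value n C w pr rk ord ch F a b r x v ->
  choice_value n C w pr rk ord ch' F' a b r x v.
Proof.
move=> ab rn E.
case=> [sg|nsg rn' kS|nsg rn' kS Ce|c nsg /andP[ac cb] opc].
- exact: ChooseLeaf.
- have [|||||<- <-] := E a b r.+1 => //; rewrite ?xpair_eqE ?leqnSn //; first lia.
  by move=> ?; apply: ChooseSkip.
- have [|||||<- <-] := E a b r.+1 => //; rewrite ?xpair_eqE ?leqnSn //; first lia.
  by move=> ?; apply: ChooseEqual.
- have [|||||<- <-] := E a c r => //; rewrite ?xpair_eqE ?leqnn //; try lia.
  have [|||||<- <-] := E c b r => //; rewrite ?xpair_eqE ?leqnn //; try lia.
  by move=> ? ?; apply: ChooseCut => //; apply/andP.
Qed.

Lemma cell_ok_ext (R : realDomainType) n (C : pred cmp) (w : nat -> R) pr rk ord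
    ch F ch' F' a b r :
  (a < b)%N -> (r <= n)%N ->
  (forall a' b' r', (a <= a')%N -> (b' <= b)%N -> (a' < b')%N -> (r <= r' <= n)%N ->
     ch' r' a' b' = ch r' a' b' /\ F' r' a' b' = F r' a' b') ->
  cell_ok n C w pr rk ord ch F a b r -> cell_ok n C w pr rk ord ch' F' a b r.
Proof.
move=> ab rn E; have [||||Ec EF] := E a b r => //; first by rewrite leqnn.
have back x v : choice_value n C w pr rk ord ch' F' a b r x v ->
    choice_value n C w pr rk ord ch F a b r x v.
  by apply: choice_value_ext => // a' b' r' h1 h2 h3 h4 _; have [||||-> ->] := E a' b' r'.
rewrite /cell_ok Ec EF => -[h1 h2]; split; first by move=> /h1 h x v /back; apply: h.
move=> /h2[h3 h4]; split; last by move=> x v /back; apply: h4.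
by apply: choice_value_ext h3 => // a' b' r' g1 g2 g3 g4 _; apply: E.
Qed.

(** * Running programs *)

Section Running.
Variable R : realType.
Implicit Types (s : state R) (c : cmd).

(** Total correctness with a time budget. The postcondition may be another [runs], which is how
    sequences are treated. *)
Definition runs c s (T : nat) (Q : state R -> Prop) : Prop :=
  exists s' t, [/\ exec c s s' t, (t <= T)%N & Q s'].

(** The effect of a loop-free command as a function, so that such commands are run by computation;
    the value on loops is a dummy. *)
Fixpoint step c s : state R :=
  match c with
  | Skip | While _ _ => s
  | NSet a e1 e2 => State (upd (nmem s) a (neval s e1) (neval s e2)) (rmem s)
  | RSet a e1 e2 => State (nmem s) (upd (rmem s) a (neval s e1) (reval s e2))
  | Seq c1 c2 => step c2 (step c1 s)
  | If b c1 c2 => if beval s b then step c1 s else step c2 s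
  end.

End Running.

Fixpoint loopfree (c : cmd) : bool :=
  match c with
  | While _ _ => false
  | Seq c1 c2 | If _ c1 c2 => loopfree c1 && loopfree c2
  | _ => true
  end.

(** Both branches of a conditional are charged, so the bound does not depend on the state; the value
    on loops is a dummy. *)
Fixpoint ctime (c : cmd) : nat :=
  match c with
  | Skip | While _ _ => 1
  | NSet _ e1 e2 => (ntime e1 + ntime e2).+1
  | RSet _ e1 e2 => (ntime e1 + rtime e2).+1
  | Seq c1 c2 => ctime c1 + ctime c2
  | If b c1 c2 => btime b + (ctime c1 + ctime c2)
  end.

Fixpoint nwrites (c : cmd) : seq nat :=
  match c with
  | NSet a _ _ => [:: a]
  | Seq c1 c2 | If _ c1 c2 => nwrites c1 ++ nwrites c2
  | While _ c1 => nwrites c1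
  | _ => [::]
  end.

Fixpoint rwrites (c : cmd) : seq nat :=
  match c with
  | RSet a _ _ => [:: a]
  | Seq c1 c2 | If _ c1 c2 => rwrites c1 ++ rwrites c2
  | While _ c1 => rwrites c1
  | _ => [::]
  end.

Fixpoint nreads (e : nexp) : seq nat :=
  match e with
  | NConst _ => [::]
  | NGet a e1 => a :: nreads e1
  | NAdd e1 e2 | NSub e1 e2 => nreads e1 ++ nreads e2
  end.

Definition var (x : nat) : nexp := NGet x (NConst 0).
Definition assign (x : nat) (e : nexp) : cmd := NSet x (NConst 0) e.

Definition For (x : nat) (e : nexp) (c : cmd) : cmd :=
  Seq (assign x (NConst 0))
    (While (BNLt (var x) e) (Seq c (assign x (NAdd (var x) (NConst 1))))).

Section Rules.
Variable R : realType.
Implicit Types (s : state R) (c : cmd) (Q : state R -> Prop).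

(** The frame condition, at the granularity of whole arrays: it can be decided from the syntax of
    [c] and carries all facts about untouched arrays across loops. *)
Definition agree c s s' : Prop :=
  (forall a, a \notin nwrites c -> nmem s' a = nmem s a) /\
  (forall a, a \notin rwrites c -> rmem s' a = rmem s a).

Lemma agree_refl c s : agree c s s. Proof. by []. Qed.

Lemma agree_trans c s1 s2 s3 : agree c s1 s2 -> agree c s2 s3 -> agree c s1 s3.
Proof.
move=> [n12 r12] [n23 r23].
by split=> a h; [rewrite n23 ?n12|rewrite r23 ?r12].
Qed.

Lemma agree_sub c c' s s' : {subset nwrites c <= nwrites c'} ->
  {subset rwrites c <= rwrites c'} -> agree c s s' -> agree c' s s'.
Proof.
move=> sn sr [hn hr]; split=> a h; [apply: hn|apply: hr].
  by apply: contra h => /sn.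
by apply: contra h => /sr.
Qed.

Lemma upd_other (T : Type) (m : nat -> nat -> T) a i x a' :
  a' != a -> upd m a i x a' = m a'.
Proof. by move=> h; apply/funext => i'; rewrite /upd (negbTE h). Qed.

Lemma exec_agree c s s' t : exec c s s' t -> agree c s s'.
Proof.
elim=> {c s s' t}.
- by [].
- by move=> s a e1 e2; split=> //= a'; rewrite inE => h; rewrite upd_other.
- by move=> s a e1 e2; split=> //= a'; rewrite inE => h; rewrite upd_other.
- move=> c1 c2 s1 s2 s3 t1 t2 _ h1 _ h2; apply: (@agree_trans _ _ s2).
    by apply: agree_sub h1 => a h /=; rewrite mem_cat h.
  by apply: agree_sub h2 => a h /=; rewrite mem_cat h orbT.
- move=> b c1 c2 s s' t _.
  by case: beval; apply: agree_sub => a h /=; rewrite mem_cat h ?orbT.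
- by [].
- by move=> b c s1 s2 s3 t1 t2 _ _ h1 _ h2; apply: agree_trans h2.
Qed.

Lemma runs_agree c s T Q : runs c s T (fun s' => agree c s s' -> Q s') ->
  runs c s T Q.
Proof.
by move=> [s' [t [e tT q]]]; exists s', t; split=> //; apply/q/(exec_agree e).
Qed.

Lemma runs_weaken c s T T' Q Q' : (T <= T')%N -> (forall s', Q s' -> Q' s') ->
  runs c s T Q -> runs c s T' Q'.
Proof.
move=> TT QQ [s' [t [e tT q]]]; exists s', t; split=> //; last exact: QQ.
exact: leq_trans TT.
Qed.

Lemma runs_seq c1 c2 s T1 T2 Q :
  runs c1 s T1 (fun s' => runs c2 s' T2 Q) -> runs (Seq c1 c2) s (T1 + T2) Q.
Proof.
move=> [s1 [t1 [e1 tT1 [s2 [t2 [e2 tT2 q]]]]]]; exists s2, (t1 + t2)%N.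
by split=> //; [apply: ExecSeq e1 e2|rewrite leq_add].
Qed.

Lemma runs_if b c1 c2 s T1 T2 Q :
  (beval s b -> runs c1 s T1 Q) -> (~~ beval s b -> runs c2 s T2 Q) ->
  runs (If b c1 c2) s (btime b + (T1 + T2)) Q.
Proof.
move=> h1 h2.
have : runs (if beval s b then c1 else c2) s (T1 + T2) Q.
  case: (boolP (beval s b)) => [/h1|/h2]; apply: runs_weaken => //.
    exact: leq_addr.
  exact: leq_addl.
move=> [s' [t [e tT q]]]; exists s', (btime b + t)%N.
by split=> //; [exact: ExecIf|rewrite leq_add2l].
Qed.

Lemma runs_step c s Q : loopfree c -> Q (step c s) -> runs c s (ctime c) Q.
Proof.
move=> lf q; exists (step c s).
suff [t e tT] : exists2 t, exec c s (step c s) t & (t <= ctime c)%N.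
  by exists t.
elim: c s lf {q Q} => [|a e1 e2|a e1 e2|c1 IH1 c2 IH2|b c1 IH1 c2 IH2|//] s /=.
- by exists 1%N => //; constructor.
- by eexists; [constructor|].
- by eexists; [constructor|].
- move=> /andP[/(IH1 s)[t1 e1 l1] /(IH2 (step c1 s))[t2 e2 l2]].
  by exists (t1 + t2)%N; [apply: ExecSeq e1 e2|rewrite leq_add].
- move=> /andP[/(IH1 s)[t1 e1 l1] /(IH2 s)[t2 e2 l2]].
  case: (boolP (beval s b)) => hb.
    exists (btime b + t1)%N; first by apply: ExecIf; rewrite hb.
    by rewrite leq_add2l (leq_trans l1) ?leq_addr.
  exists (btime b + t2)%N; first by apply: ExecIf; rewrite (negbTE hb).
  by rewrite leq_add2l (leq_trans l2) ?leq_addl.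
Qed.

Lemma step_agree c s : loopfree c -> agree c s (step c s).
Proof.
by move=> lf; have [s' [t [e _ ->]]] := runs_step (Q := eq (step c s)) lf erefl; apply: exec_agree e.
Qed.

Lemma runs_le c s T T' Q : runs c s T Q -> (T <= T')%N -> runs c s T' Q.
Proof. by move=> h TT; apply: runs_weaken h. Qed.

Lemma runs_while (I : nat -> state R -> Prop) b c s N T :
  I 0%N s ->
  (forall k s', (k <= N)%N -> agree c s s' -> I k s' ->
     beval s' b = (k < N)%N) ->
  (forall k s', (k < N)%N -> agree c s s' -> I k s' -> runs c s' T (I k.+1)) ->
  runs (While b c) s (N * (btime b + T) + btime b) (fun s' => I N s' /\ agree c s s').
Proof.
move=> I0 hb hc.
suff gen k s1 : (k <= N)%N -> agree c s s1 -> I k s1 ->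
    runs (While b c) s1 ((N - k) * (btime b + T) + btime b)
      (fun s' => I N s' /\ agree c s s').
  by have := gen 0%N s (leq0n _) (agree_refl _ _) I0; rewrite subn0.
have [m] := ubnP (N - k)%N; elim: m k s1 => // m IH k s1 km kN ag Ik.
have := hb _ _ kN ag Ik; case: (ltnP k N) => [kN' bt|Nk bf].
  have [s2 [t2 [e2 l2 I2]]] := hc _ _ kN' ag Ik.
  have ag2 := agree_trans ag (exec_agree e2).
  have [|s3 [t3 [e3 l3 I3]]] := IH k.+1 s2 _ kN' ag2 I2; first by lia.
  exists s3, (btime b + t2 + t3)%N; split=> //; first exact: ExecWhileLoop e2 e3.
  have -> : (N - k = (N - k.+1).+1)%N by lia.
  rewrite mulSn; lia.
have kE : k = N by lia.
exists s1, (btime b); rewrite kE in Ik; split=> //.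
  by apply: ExecWhileDone; rewrite bf.
exact: leq_addl.
Qed.

Lemma neval_agree c s s' e : all (fun a => a \notin nwrites c) (nreads e) ->
  agree c s s' -> neval s' e = neval s e.
Proof.
move=> + [hn _]; elim: e => [//|a e IH|e1 IH1 e2 IH2|e1 IH1 e2 IH2] /=.
- by move=> /andP[ha /IH ->]; rewrite hn.
- by rewrite all_cat => /andP[/IH1 -> /IH2 ->].
- by rewrite all_cat => /andP[/IH1 -> /IH2 ->].
Qed.

Definition set_var s x v : state R := State (upd (nmem s) x 0 v) (rmem s).

(** The counter is incremented after the body, so the invariant must not depend on it. Each pass
    costs, besides the body, 6 for the increment and [ntime e + 3] for the guard; initialising costs
    3 and the last failing guard [ntime e + 3]. *)
Lemma runs_for (I : nat -> state R -> Prop) x e c s N T :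
  x \notin nwrites c ->
  all (fun a => (a != x) && (a \notin nwrites c)) (nreads e) ->
  neval s e = N ->
  I 0%N s ->
  (forall k s' v, (k <= N)%N -> I k s' -> I k (set_var s' x v)) ->
  (forall k s', (k < N)%N -> agree (For x e c) s s' -> nmem s' x 0 = k ->
     I k s' -> runs c s' T (I k.+1)) ->
  runs (For x e c) s (N * (T + ntime e + 9) + ntime e + 6)
    (fun s' => I N s' /\ agree (For x e c) s s').
Proof.
move=> xc re eN I0 Iset step1.
pose c1 := Seq c (assign x (NAdd (var x) (NConst 1))).
have agF s1 s2 : agree c1 s1 s2 -> agree (For x e c) s1 s2.
  by apply: agree_sub => a h //=; rewrite inE h orbT.
have e_ok s' : agree (For x e c) s s' -> neval s' e = N.
  move=> ag; rewrite (@neval_agree (For x e c) s) //.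
  apply: sub_all re => a /andP[ax ac] /=.
  by rewrite inE mem_cat !inE !negb_or ax ac.
have w1 : runs (While (BNLt (var x) e) c1) (set_var s x 0)
   (N * (btime (BNLt (var x) e) + (T + 6)) + btime (BNLt (var x) e))
   (fun s' => (I N s' /\ nmem s' x 0 = N) /\ agree c1 (set_var s x 0) s').
  have ag0 : agree (For x e c) s (set_var s x 0).
    by split=> //= a; rewrite inE negb_or => /andP[h _]; rewrite upd_other.
  apply: (@runs_while (fun k s' => I k s' /\ nmem s' x 0 = k)).
  - by split; [exact: Iset|rewrite /= /upd !eqxx].
  - move=> k s' kN ag [Ik xk] /=; rewrite xk; congr (_ < _)%N.
    by apply: e_ok; apply: agree_trans ag0 (agF _ _ ag).
  - move=> k s' kN ag [Ik xk].
    apply: runs_seq.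
    have := step1 k s' kN (agree_trans ag0 (agF _ _ ag)) xk Ik.
    move=> [s2 [t2 [e2 l2 I2]]]; exists s2, t2; split=> //.
    apply: runs_step => //=; have [hn _] := exec_agree e2; rewrite hn // xk.
    by split; [rewrite addn1; apply: Iset|rewrite /= /upd !eqxx addn1].
have := @runs_seq (assign x (NConst 0)) _ s 3 _ _ (runs_step _ w1).
move=> /(_ isT); apply: runs_weaken.
  rewrite /=; nia.
move=> s' [[IN xN] ag]; split=> //.
have ag0 : agree (For x e c) s (set_var s x 0).
  by split=> //= a; rewrite inE negb_or => /andP[h _]; rewrite upd_other.
exact: agree_trans ag0 (agF _ _ ag).
Qed.

End Rules.

(** * The dynamic program *)

(* A scalar variable [x...] lives in cell 0 of the array of that name. *)
Local Notation xN := 0%N (only parsing).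
Local Notation aKeyQ := 1%N (only parsing).
Local Notation aGapQ := 2%N (only parsing).
Local Notation aOps := 3%N (only parsing).
Local Notation xLen := 4%N (only parsing).
Local Notation aOut := 5%N (only parsing).
Local Notation xM := 6%N (only parsing).
Local Notation xI := 7%N (only parsing).
Local Notation xJ := 8%N (only parsing).
Local Notation aPr := 9%N (only parsing).
Local Notation aRk := 10%N (only parsing).
Local Notation aOrd := 11%N (only parsing).
Local Notation aCut := 12%N (only parsing).
Local Notation aKey := 13%N (only parsing).
Local Notation aRow := 14%N (only parsing).
Local Notation aPlane := 15%N (only parsing).
Local Notation aCh := 16%N (only parsing).
Local Notation xR := 17%N (only parsing).
Local Notation xA := 18%N (only parsing).
Local Notation xB := 19%N (only parsing).
Local Notation xC := 20%N (only parsing).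
Local Notation xColumn := 21%N (only parsing).
Local Notation xRow := 22%N (only parsing).
Local Notation xK := 23%N (only parsing).
Local Notation xCell := 24%N (only parsing).
Local Notation xCount := 25%N (only parsing).
Local Notation xSp := 26%N (only parsing).
Local Notation aStA := 27%N (only parsing).
Local Notation aStB := 28%N (only parsing).
Local Notation aStR := 29%N (only parsing).
Local Notation rAlpha := 1%N (only parsing).
Local Notation rBeta := 2%N (only parsing).
Local Notation rW := 3%N (only parsing).
Local Notation rF := 4%N (only parsing).
Local Notation rSum := 5%N (only parsing).

(* Programs have no real literals. *)
Definition rzero : rexp := RSub (RGet rSum (NConst 0)) (RGet rSum (NConst 0)).
Definition address (r a b : nexp) : nexp :=
  NAdd (NAdd (NGet aPlane r) (NGet aRow a)) b.
Definition cell : nexp := var xCell.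
Definition choice_at (e : nexp) : nexp := NGet aCh e.
Definition cost_at (e : nexp) : rexp := RGet rF e.
Definition positive (e : nexp) : bexp := BNLt (NConst 0) e.
Definition next_rank : nexp := address (NAdd (var xR) (NConst 1)) (var xA) (var xB).
Definition sum_weights : rexp := RGet rSum (NConst 0).
Definition contains (p : nexp) : bexp :=
  BAnd (BAnd (BNot (BNLt p (var xA))) (BNLt p (var xB)))
    (BAnd (positive (NGet aPr p)) (BNot (BNLt (NGet aRk p) (var xR)))).

(** Weight and number of members are computed afresh for every entry: this is linear time, no more
    than the loop over cuts costs anyway. *)
Definition measure_cell : cmd :=
  Seq (Seq (assign xCell (address (var xR) (var xA) (var xB)))
      (Seq (assign xCount (NConst 0)) (RSet rSum (NConst 0) rzero)))
    (For xJ (var xB)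
       (If (contains (var xJ))
          (Seq (assign xCount (NAdd (var xCount) (NConst 1)))
               (RSet rSum (NConst 0) (RAdd sum_weights (RGet rW (var xJ)))))
          Skip)).

Definition choose (x : nexp) (v : rexp) : cmd :=
  Seq (NSet aCh cell x) (RSet rF cell v).

Definition try_key : cmd :=
  If (BAnd (BNLt (var xR) (var xN)) (positive (choice_at next_rank)))
    (Seq
       (assign xK (NAdd (NAdd (NGet aOrd (var xR)) (NGet aOrd (var xR))) (NConst 1)))
       (If (contains (var xK))
          (If (positive (NGet aOps (NConst 2)))
             (choose (NConst 3) (RAdd sum_weights (cost_at next_rank)))
             Skip)
          (choose (NConst 2) (cost_at next_rank))))
    Skip.

Definition left_part : nexp := address (var xR) (var xA) (var xC).
Definition right_part : nexp := address (var xR) (var xC) (var xB).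
Definition cut_cost : rexp :=
  RAdd (RAdd sum_weights (cost_at left_part)) (cost_at right_part).

(** The last conjunct, spelled without disjunction, says that no choice is recorded yet or that this
    cut is strictly cheaper. *)
Definition try_cut : cmd :=
  If (BAnd (BNLt (var xA) (var xC))
     (BAnd (positive (NGet aCut (var xC)))
     (BAnd (positive (choice_at left_part))
     (BAnd (positive (choice_at right_part))
       (BNot (BAnd (positive (choice_at cell))
                   (BNot (BRLt cut_cost (cost_at cell)))))))))
    (choose (NAdd (NConst 3) (var xC)) cut_cost)
    Skip.

Definition solve_cell : cmd :=
  Seq measure_cell
    (If (BNLt (var xCount) (NConst 2))
       (choose (NConst 1) rzero)
       (Seq (Seq (NSet aCh cell (NConst 0)) try_key)
            (For xC (var xB) try_cut))).

(** The left end runs downwards from [b - 1] to 0, so that the right parts, which share the end [b],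
    are ready when a cut needs them. *)
Definition solve_column : cmd :=
  For xRow (var xB) (Seq (assign xA (NSub (var xColumn) (var xRow))) solve_cell).

Definition solve_plane : cmd :=
  For xColumn (var xM) (Seq (assign xB (NAdd (var xColumn) (NConst 1))) solve_column).

Definition solve_all : cmd :=
  For xI (NAdd (var xN) (NConst 1))
    (Seq (assign xR (NSub (var xN) (var xI)))
      solve_plane).

(** Row-major order in base 2n+2, since interval ends range over 0, ..., 2n+1; injectivity is
    uniqueness of digits. *)
Definition addr (n r a b : nat) : nat :=
  (r * ((n + n).+2 * (n + n).+2) + a * (n + n).+2 + b)%N.

Lemma addr_inj n r a b r' a' b' : (a <= (n + n).+1)%N -> (b <= (n + n).+1)%N ->
  (a' <= (n + n).+1)%N -> (b' <= (n + n).+1)%N ->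
  addr n r a b = addr n r' a' b' -> [/\ r = r', a = a' & b = b'].
Proof.
rewrite /addr; set m := (n + n).+2 => ha hb ha' hb'.
have lb x y : (y <= (n + n).+1)%N -> ((x * m + y) %/ m = x)%N.
  by move=> yl; rewrite divnMDl // divn_small ?addn0.
have lm x y : (y <= (n + n).+1)%N -> ((x * m + y) %% m = y)%N.
  by move=> yl; rewrite modnMDl modn_small.
have E x y z : (x * (m * m) + y * m + z = (x * m + y) * m + z)%N.
  by rewrite mulnA -mulnDl.
rewrite !E => e.
have e1 := congr1 (divn^~ m) e; have e2 := congr1 (modn^~ m) e.
rewrite /= !lb // in e1; rewrite /= !lm // in e2.
have e3 := congr1 (divn^~ m) e1; have e4 := congr1 (modn^~ m) e1.
by rewrite /= !lb // in e3; rewrite /= !lm // in e4.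
Qed.

(** * Verification of the dynamic program *)

Section Solving.
Variables (R : realType) (n : nat) (C : pred cmp) (w : nat -> R).
Variables (pr : pred nat) (rk ord : nat -> nat).

Notation M := (n + n).+1.

Record ready (s : state R) : Prop := Ready {
  ready_n : nmem s xN 0 = n;
  ready_M : nmem s xM 0 = M;
  ready_pr : forall p, (p <= n + n)%N -> nmem s aPr p = pr p;
  ready_rk : forall p, (p <= n + n)%N -> nmem s aRk p = rk p;
  ready_w : forall p, (p <= n + n)%N -> rmem s rW p = w p;
  ready_ord : forall r, (r < n)%N -> nmem s aOrd r = ord r;
  ready_cut : forall c, (0 < c <= n + n)%N -> nmem s aCut c = cut_op C c;
  ready_key : forall c, (0 < c <= n + n)%N -> nmem s aKey c = c.-1./2;
  ready_eq : nmem s aOps 2 = C CEq;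
  ready_row : forall a, (a <= M)%N -> nmem s aRow a = (a * M.+1)%N;
  ready_plane : forall r, (r <= n.+1)%N -> nmem s aPlane r = (r * (M.+1 * M.+1))%N
}.

Definition static : seq nat :=
  [:: xN; xM; aPr; aRk; aOrd; aCut; aKey; aOps; aRow; aPlane].

Lemma ready_agree c s s' : all (fun a => a \notin nwrites c) static ->
  rW \notin rwrites c -> agree c s s' -> ready s -> ready s'.
Proof.
rewrite /= => /and5P[h1 h2 h3 h4 /and5P[h5 h6 h7 h8 /and3P[h9 h10 _]]] hr [hn hm].
move=> [r1 r2 r3 r4 r5 r6 r7 r8 r9 r10 r11].
by constructor; rewrite ?hn ?hm.
Qed.

Definition tch (s : state R) r a b := nmem s aCh (addr n r a b).
Definition tF (s : state R) r a b := rmem s rF (addr n r a b).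

Lemma neval_address s er ea eb : ready s -> (neval s er <= n.+1)%N ->
  (neval s ea <= M)%N ->
  neval s (address er ea eb) = addr n (neval s er) (neval s ea) (neval s eb).
Proof. by move=> rd hr ha; rewrite /= (ready_row rd) // (ready_plane rd). Qed.

Lemma beval_contains s e : ready s -> (nmem s xB 0 <= M)%N ->
  beval s (contains e) = sub pr rk (nmem s xA 0) (nmem s xB 0) (nmem s xR 0) (neval s e).
Proof.
move=> rd bM /=; rewrite /sub -leqNgt.
case: ltnP => pb; last by rewrite /= !andbF.
have pn : (neval s e <= n + n)%N by lia.
by rewrite (ready_pr rd) // (ready_rk rd) // -leqNgt andbT lt0b /= andbA.
Qed.

Lemma count_lt2 (S : pred nat) b : (forall p, S p -> (p < b)%N) ->
  (count S (iota 0 b) < 2)%N <-> subsing S.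
Proof.
move=> Sb; rewrite -size_filter.
have mS p : S p -> p \in [seq x <- iota 0 b | S x].
  by move=> Sp; rewrite mem_filter Sp mem_iota /= Sb.
have := filter_uniq S (iota_uniq 0 b).
have Sm p : p \in [seq x <- iota 0 b | S x] -> S p by rewrite mem_filter => /andP[].
case: [seq x <- iota 0 b | S x] mS Sm => [|x [|y l]] mS Sm un; split=> //.
- by move=> _ p q /mS.
- by move=> _ p q /mS; rewrite inE => /eqP -> /mS; rewrite inE => /eqP ->.
- move=> sg; move: un; rewrite /= inE negb_or.
  have -> : x = y by apply: sg; apply: Sm; rewrite !inE eqxx ?orbT.
  by rewrite eqxx.
Qed.

Lemma wt_below_bound (S : pred nat) b : (b <= M)%N -> (forall p, S p -> (p < b)%N) ->
  \sum_(0 <= p < b | S p) w p = wt n w S.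
Proof.
move=> bM Sb; rewrite (big_nat_widen _ _ M) // big_mkord /wt.
by apply: eq_bigl => p; case: (boolP (S p)) => // /Sb ->.
Qed.

Lemma measure_ok s a b r : ready s ->
  nmem s xA 0 = a -> nmem s xB 0 = b -> nmem s xR 0 = r ->
  (a < b <= M)%N -> (r <= n)%N ->
  runs measure_cell s (250 * n.+1) (fun s' =>
    [/\ agree measure_cell s s', nmem s' xCell 0 = addr n r a b,
        rmem s' rSum 0 = wt n w (sub pr rk a b r) &
        (nmem s' xCount 0 < 2)%N <-> subsing (sub pr rk a b r)]).
Proof.
move=> rd ha hb hr /andP[ab bM] rn.
have Sb p : sub pr rk a b r p -> (p < b)%N by case/and4P.
eapply runs_le.
  apply: runs_agree.
  apply: runs_seq; apply: runs_step => //.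
  match goal with |- runs _ (step ?c _) _ _ => have ag0 : agree c s (step c s) by exact: step_agree end.
  set s0 := step _ _ in ag0 *.
  have cE : nmem s0 xCell 0 = addr n r a b.
    rewrite /= (ready_plane rd) ?(ready_row rd) ?ha ?hr ?hb //; lia.
  have rd0 : ready s0 by exact: ready_agree ag0 rd.
  eapply runs_weaken; [exact: leqnn| |].
  2: apply: (@runs_for _ (fun k s' => nmem s' xCount 0 = count (sub pr rk a b r) (iota 0 k)
       /\ rmem s' rSum 0 = \sum_(0 <= p < k | sub pr rk a b r p) w p) _ _ _ _ b) => //.
  - move=> s' [[I1 I2] [ag1 ag2]] ag; split=> //.
    + by rewrite ag1.
    + by rewrite I2 wt_below_bound.
    + by rewrite I1 count_lt2.
  - by split; rewrite /= ?big_nil // /upd /= subrr.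
  - move=> k s' kb ag xk [I1 I2].
    have rd' : ready s' by exact: ready_agree ag rd0.
    have [ag1 _] := ag.
    have CE : beval s' (contains (var xJ)) = sub pr rk a b r k.
      have vA : nmem s' xA 0 = a by rewrite ag1.
      have vB : nmem s' xB 0 = b by rewrite ag1.
      have vR : nmem s' xR 0 = r by rewrite ag1.
      by rewrite (beval_contains _ rd') ?vA ?vB ?vR //= xk.
    have Ek : count (sub pr rk a b r) (iota 0 k.+1) = (count (sub pr rk a b r) (iota 0 k) + sub pr rk a b r k)%N.
      by rewrite -addn1 iotaD count_cat /= addn0.
    have Wk : \sum_(0 <= p < k.+1 | sub pr rk a b r p) w p =
        \sum_(0 <= p < k | sub pr rk a b r p) w p + (if sub pr rk a b r k then w k else 0).
      by rewrite [LHS]big_mkcond big_nat_recr //= -big_mkcond.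
    rewrite Ek Wk.
    apply: runs_if; rewrite CE => hk; apply: runs_step => //.
      rewrite hk /= /upd /= xk I1 I2 (ready_w rd') ?addn1 //; lia.
    by rewrite (negbTE hk) /= I1 I2 addn0 addr0.
rewrite /=; lia.
Qed.

Lemma beval_and (s : state R) x y : beval s (BAnd x y) = beval s x && beval s y.
Proof. by []. Qed.

Lemma beval_not (s : state R) x : beval s (BNot x) = ~~ beval s x.
Proof. by []. Qed.

Lemma beval_nlt (s : state R) x y : beval s (BNLt x y) = (neval s x < neval s y)%N.
Proof. by []. Qed.

Lemma beval_rlt (s : state R) x y : beval s (BRLt x y) = (reval s x < reval s y).
Proof. by []. Qed.

Lemma beval_choice (s : state R) e :
  beval s (positive (choice_at e)) = (nmem s aCh (neval s e) != 0%N).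
Proof. by rewrite -lt0n. Qed.

Lemma reval_add (s : state R) x y : reval s (RAdd x y) = reval s x + reval s y.
Proof. by []. Qed.

Lemma reval_cost (s : state R) e : reval s (cost_at e) = rmem s rF (neval s e).
Proof. by []. Qed.

Lemma reval_sum (s : state R) : reval s sum_weights = rmem s rSum 0.
Proof. by []. Qed.

Lemma neval_var (s : state R) x : neval s (var x) = nmem s x 0.
Proof. by []. Qed.

Definition bevalE := (beval_and, beval_not, beval_choice, beval_nlt, beval_rlt,
  reval_add, reval_cost, reval_sum, neval_var).

Lemma addr_neq r a b r' a' b' : (a <= M)%N -> (b <= M)%N ->
  (a' <= M)%N -> (b' <= M)%N -> (r, a, b) != (r', a', b') ->
  addr n r' a' b' != addr n r a b.
Proof.
by move=> ha hb ha' hb' ne; apply: contra ne => /eqP /addr_inj[] // -> -> ->.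
Qed.

Definition same_except (ad : nat) (s s' : state R) : Prop :=
  forall i, i != ad -> nmem s' aCh i = nmem s aCh i /\ rmem s' rF i = rmem s rF i.

Section Cell.
Variables (s1 : state R) (a b r : nat).
Hypotheses (abM : (a < b <= M)%N) (rn : (r <= n)%N).
Let ad := addr n r a b.
Let S := sub pr rk a b r.
(** Choices are valued against the table as it stands in [s1], before this entry is overwritten. *)
Let cv := choice_value n C w pr rk ord (tch s1) (tF s1) a b r.

Definition vars_ok (s : state R) : Prop :=
  [/\ ready s, [/\ nmem s xA 0 = a, nmem s xB 0 = b, nmem s xR 0 = r
    & nmem s xCell 0 = ad] & rmem s rSum 0 = wt n w S].

Notation same_table := (same_except ad s1).

(** Codes below 4 are the choices other than cuts, and the cuts at positions below [k] have codes
    below [3 + k]. The [maxn] matters at [k = 0], where the equality test, of code 3, has already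
    been tried. *)
Definition best_upto k (s : state R) : Prop :=
  [/\ same_table s,
      nmem s aCh ad = 0%N -> forall x v, (x < maxn 4 (3 + k))%N -> ~ cv x v
    & nmem s aCh ad != 0%N -> cv (nmem s aCh ad) (rmem s rF ad) /\
        forall x v, (x < maxn 4 (3 + k))%N -> cv x v -> rmem s rF ad <= v].

Lemma vars_agree c s s' : all (fun a => a \notin nwrites c) (static ++ [:: xA; xB; xR; xCell]) ->
  (rW \notin rwrites c) && (rSum \notin rwrites c) -> agree c s s' -> vars_ok s -> vars_ok s'.
Proof.
rewrite all_cat => /andP[hs /and5P[h1 h2 h3 h4 _]] /andP[hw hsum] ag [rd [e1 e2 e3 e4] e5].
have [n1 n2] := ag; split; first exact: ready_agree ag rd.
  by rewrite !n1.
by rewrite n2.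
Qed.

(** [choose] writes the code before it evaluates the cost; the last hypothesis says that the cost
    does not notice this write. *)
Lemma chosen_ok s k x v : vars_ok s -> same_table s -> neval s k = x -> x != 0%N ->
  reval s v = reval (State (upd (nmem s) aCh ad x) (rmem s)) v ->
  let s' := step (choose k v) s in
  [/\ same_table s', nmem s' aCh ad = x & rmem s' rF ad = reval s v].
Proof.
move=> [rd [hA hB hR hC] hW] st kx x0 vv /=; rewrite hC kx -vv.
split.
- move=> i ine; have [<- <-] := st _ ine.
  by rewrite /upd /= hC (negbTE ine).
- by rewrite /upd /= eqxx.
- by rewrite /upd /= hC eqxx.
Qed.

Lemma small_choice x v : ~ subsing S -> (x < 4)%N -> cv x v ->
  [/\ (r < n)%N, tch s1 r.+1 a b != 0%N &
    (x = 2%N /\ ~~ S (keypos (ord r)) /\ v = tF s1 r.+1 a b) \/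
    (x = 3%N /\ S (keypos (ord r)) /\ C CEq /\ v = wt n w S + tF s1 r.+1 a b)].
Proof.
move=> nsg x4 h; case: h x4 => [//|nsg' rn' kS ch1 _|nsg' rn' kS Ce ch1 _|c nsg' abc].
- by split=> //; left.
- by split=> //; right.
- by move=> _ _ _ c4; exfalso; lia.
Qed.

Lemma cut_choice c x v : (0 < c)%N -> x = (3 + c)%N -> cv x v ->
  [/\ (a < c < b)%N, cut_op C c != 0%N, tch s1 r a c != 0%N, tch s1 r c b != 0%N
    & v = wt n w S + tF s1 r a c + tF s1 r c b].
Proof.
move=> c0 xc h; case: h xc => [_|_ _ _ _|_ _ _ _ _|d nsg abd opd ch1 ch2] xc; try (exfalso; lia).
have <- : d = c by lia.
by split.
Qed.

Lemma neval_next_rank s : vars_ok s -> (r < n)%N ->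
  neval s next_rank = addr n r.+1 a b.
Proof.
move=> [rd [hA hB hR _] _] rn'.
by rewrite (neval_address _ rd) /= ?hA ?hB ?hR ?addn1 //; lia.
Qed.

Lemma try_key_ok s : vars_ok s -> same_table s -> nmem s aCh ad = 0%N ->
  ~ subsing S -> runs try_key s (ctime try_key) (best_upto 0).
Proof.
move=> vs st ch0 nsg; have [rd [hA hB hR hC] hW] := vs.
have nxt (rn' : (r < n)%N) : [/\ neval s next_rank = addr n r.+1 a b,
    nmem s aCh (addr n r.+1 a b) = tch s1 r.+1 a b
    & rmem s rF (addr n r.+1 a b) = tF s1 r.+1 a b].
  have [|h1 h2] := st (addr n r.+1 a b); last first.
    by split; [exact: neval_next_rank|exact: h1|exact: h2].
  by apply: addr_neq; rewrite ?xpair_eqE; lia.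
apply: runs_if.
  rewrite !bevalE hR (ready_n rd) => /andP[rn'].
  have [nE cE FE] := nxt rn'.
  rewrite nE cE => ch1.
  apply: runs_seq; apply: runs_step => //.
  set c := assign _ _; have vs2 : vars_ok (step c s).
    by apply: (@vars_agree c s) => //; exact: step_agree.
  have st2 : same_table (step c s) by [].
  have ch02 : nmem (step c s) aCh ad = 0%N by [].
  have nE2 : neval (step c s) next_rank = addr n r.+1 a b.
    exact: neval_next_rank.
  have FE2 : rmem (step c s) rF (addr n r.+1 a b) = tF s1 r.+1 a b by [].
  have kE : neval (step c s) (var xK) = keypos (ord r).
    by rewrite /= /upd /= hR (ready_ord rd) // addn1.
  have W2 : rmem (step c s) rSum 0 = wt n w S by [].
  have opE : nmem (step c s) aOps 2 = C CEq by exact: (ready_eq rd).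
  have [rd2 [hA2 hB2 hR2 hC2] _] := vs2.
  have bM : (nmem (step c s) xB 0 <= M)%N by rewrite hB2; lia.
  have Cn := beval_contains (var xK) rd2 bM.
  rewrite hA2 hB2 hR2 kE in Cn.
  move: (step c s) vs2 st2 ch02 nE2 FE2 W2 opE Cn => s2 vs2 st2 ch02 nE2 FE2 W2 opE Cn {c kE rd2 hA2 hB2 hR2 hC2 bM}.
  apply: runs_if; rewrite Cn => kS.
    apply: runs_if.
      rewrite /= opE lt0b => Ce; apply: runs_step => //.
      have [||||st3 c3 F3] := @chosen_ok s2 (NConst 3) 3
        (RAdd sum_weights (cost_at next_rank)) vs2 => //.
      split; rewrite ?c3 ?F3 // => _; rewrite !bevalE nE2 FE2 W2.
      split; first exact: ChooseEqual.
      move=> x v x4 /(small_choice nsg x4)[_ _ [[_ [nkS _]]|[_ [_ [_ ->]]]]] //.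
      by rewrite /S kS in nkS.
    rewrite /= opE lt0b => Ce; apply: runs_step => //=.
    split; rewrite ?ch02 // => _ x v x4 /(small_choice nsg x4)[_ _ [[_ [nkS _]]|[_ [_ [Ce' _]]]]].
      by rewrite /S kS in nkS.
    by rewrite Ce' in Ce.
  apply: runs_step => //.
  have [||||st3 c3 F3] := @chosen_ok s2 (NConst 2) 2 (cost_at next_rank) vs2 => //.
  split; rewrite ?c3 ?F3 // => _; rewrite !bevalE nE2 FE2.
  split; first exact: ChooseSkip.
  move=> x v x4 /(small_choice nsg x4)[_ _ [[_ [_ ->]]|[_ [kS' _]]]] //.
  by rewrite /S (negbTE kS) in kS'.
move=> nb; apply: runs_step => //=; split; rewrite ?ch0 //.
move=> _ x v x4 /(small_choice nsg x4)[rn' ch1 _].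
have [nE cE FE] := nxt rn'.
by case/negP: nb; rewrite !bevalE hR (ready_n rd) rn' nE cE ch1.
Qed.

Lemma try_cut_ok s k : vars_ok s -> best_upto k s -> nmem s xC 0 = k ->
  (k < b)%N -> ~ subsing S -> runs try_cut s (ctime try_cut) (best_upto k.+1).
Proof.
move=> vs [st b0 b1] hk kb nsg; have [rd [hA hB hR hC] hW] := vs.
have lE : neval s left_part = addr n r a k.
  by rewrite (neval_address _ rd) /= ?hA ?hk ?hR //; lia.
have rE : neval s right_part = addr n r k b.
  by rewrite (neval_address _ rd) /= ?hB ?hk ?hR //; lia.
have lT : (a < k)%N -> nmem s aCh (addr n r a k) = tch s1 r a k /\
    rmem s rF (addr n r a k) = tF s1 r a k.
  by move=> ak; apply: st; apply: addr_neq; rewrite ?xpair_eqE; lia.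
have rT : (a < k)%N -> nmem s aCh (addr n r k b) = tch s1 r k b /\
    rmem s rF (addr n r k b) = tF s1 r k b.
  by move=> ak; apply: st; apply: addr_neq; rewrite ?xpair_eqE; lia.
have costE : (a < k)%N -> reval s cut_cost = wt n w S + tF s1 r a k + tF s1 r k b.
  move=> ak; rewrite !bevalE lE rE hW.
  by rewrite (lT ak).2 (rT ak).2.
(* Stage [k] adds only the code of the cut at [k], and nothing for [k = 0], because code 3 belongs
   to the equality test. *)
have new x : (x < maxn 4 (3 + k.+1))%N ->
    (x < maxn 4 (3 + k))%N \/ (0 < k)%N /\ x = (3 + k)%N by lia.
have cutE : (a < k)%N -> beval s (positive (NGet aCut (var xC))) = (cut_op C k != 0%N).
  by move=> ak; rewrite /= hk (ready_cut rd) ?lt0n //; lia.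
apply: runs_if.
  rewrite !beval_and beval_nlt !neval_var hA hk => /andP[ak].
  rewrite cutE // !bevalE lE rE (lT ak).1 (rT ak).1 => /and4P[opk chl chr better].
  apply: runs_step => //.
  have [||||st3 c3 F3] := @chosen_ok s (NAdd (NConst 3) (var xC)) (3 + k) cut_cost vs => //.
    by rewrite /= hk.
  split; rewrite ?c3 ?F3 // => _; rewrite costE //; split.
    by apply: ChooseCut => //; rewrite ak.
  move=> x v x4 cx; case: (new _ x4) => [x4'|[k0 xk]].
    move: better; rewrite negb_and !negbK hC => /orP[/eqP c0|].
      by case: (b0 c0 _ _ x4' cx).
    rewrite hW (lT ak).2 (rT ak).2 => lt.
    have [c0|c0] := eqVneq (nmem s aCh ad) 0%N; first by case: (b0 c0 _ _ x4' cx).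
    by have [_ /(_ _ _ x4' cx) h] := b1 c0; apply: ltW; apply: lt_le_trans h.
  by have [_ _ _ _ ->] := cut_choice k0 xk cx.
move=> nb; apply: runs_step => //=.
have hnew x v : x = (3 + k)%N -> (0 < k)%N -> cv x v ->
    nmem s aCh ad != 0%N /\ rmem s rF ad <= v.
  move=> xk k0 cx; have [/andP[ak _] opk chl chr vE] := cut_choice k0 xk cx.
  move: nb; rewrite !beval_and cutE // !bevalE hA hk ak lE rE (lT ak).1 (rT ak).1.
  by rewrite opk chl chr /= !negbK hC hW (lT ak).2 (rT ak).2 -vE -leNgt => /andP[].
split=> // [c0 x v x4 cx|c0].
  case: (new _ x4) => [x4'|[k0 xk]]; first exact: b0 cx.
  by have [] := hnew _ _ xk k0 cx; rewrite c0.
have [h1 h2] := b1 c0; split=> // x v x4 cx.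
case: (new _ x4) => [x4'|[k0 xk]]; first exact: h2 cx.
by have [] := hnew _ _ xk k0 cx.
Qed.

End Cell.

Definition solved (s : state R) := cell_ok n C w pr rk ord (tch s) (tF s).

Lemma solve_cell_ok s a b r : ready s ->
  nmem s xA 0 = a -> nmem s xB 0 = b -> nmem s xR 0 = r ->
  (a < b <= M)%N -> (r <= n)%N ->
  runs solve_cell s (900 * n.+1) (fun s' =>
    same_except (addr n r a b) s s' /\ solved s' a b r).
Proof.
move=> rd hA hB hR abM rn; set S := sub pr rk a b r.
eapply runs_le.
  apply: runs_seq.
  eapply runs_weaken; [exact: leqnn| |exact: (measure_ok rd hA hB hR abM rn)].
  move=> s1 /= [[ag1 ag2] hC hW hcnt].
  have vs1 : vars_ok a b r s1.
    split=> //; last by split; rewrite ?hC // ag1.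
    by apply: (@ready_agree measure_cell s).
  have hch i : nmem s1 aCh i = nmem s aCh i by rewrite ag1.
  have hF i : rmem s1 rF i = rmem s rF i by rewrite ag2.
  (* Transfers choices between the table before and after the write: the entries they read have
     other addresses. *)
  have sep s' : same_except (addr n r a b) s1 s' -> forall a' b' r', (a <= a')%N -> (b' <= b)%N ->
      (a' < b')%N -> (r <= r' <= n)%N -> (r, a, b) != (r', a', b') ->
      tch s1 r' a' b' = tch s' r' a' b' /\ tF s1 r' a' b' = tF s' r' a' b'.
    move=> st a' b' r' h1 h2 h3 h4 h5; rewrite /tch /tF.
    by have [|-> ->] := st (addr n r' a' b'); first by apply: addr_neq => //; lia.
  have ab : (a < b)%N by case/andP: abM.
  have se s' : same_except (addr n r a b) s1 s' -> same_except (addr n r a b) s s'.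
    by move=> st i /st; rewrite hch hF.
  apply: runs_if => /=.
    rewrite hcnt => sg; apply: runs_step => //.
    have [||||st3 c3 F3] := @chosen_ok s1 a b r s1 (NConst 1) 1 rzero vs1 => //.
    split; first exact: se.
    split; rewrite /tch c3 // => _; rewrite /tF F3 /= subrr; split; first exact: ChooseLeaf.
    by move=> x v; case.
  move=> /negP nsg; have {}nsg : ~ subsing S by move=> sg; apply/nsg/hcnt.
  apply: runs_seq; apply: runs_seq; apply: runs_step => //.
  set c := NSet _ _ _; set s2 := step c s1.
  have vs2 : vars_ok a b r s2 by apply: (@vars_agree a b r c s1) => //; exact: step_agree.
  have st2 : same_except (addr n r a b) s1 s2.
    by move=> i ine; rewrite /s2 /= /upd /= hC (negbTE ine).
  have c2 : nmem s2 aCh (addr n r a b) = 0%N by rewrite /s2 /= /upd /= hC eqxx.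
  apply: runs_agree.
  apply: runs_weaken (try_key_ok abM rn vs2 st2 c2 nsg) => [|s3 best3 ag3]; first exact: leqnn.
  have vs3 : vars_ok a b r s3 by exact: vars_agree ag3 vs2.
  eapply runs_weaken; [exact: leqnn| |].
  2: apply: (@runs_for _ (best_upto s1 a b r) _ _ _ _ b _) => //.
  - move=> s' [[st b0 b1] ag]; split; first exact: se.
    split; rewrite {1}/tch => hc.
      move=> x v cx; apply: (b0 hc x v).
        by case: cx => *; lia.
      by apply: choice_value_ext cx => //; apply: sep.
    have [h1 h2] := b1 hc; split.
      apply: choice_value_ext h1 => // a' b' r' p1 p2 p3 p4 p5.
      by have [-> ->] := sep _ st a' b' r' p1 p2 p3 p4 p5.
    move=> x v cx; apply: (h2 x v).
      by case: cx => *; lia.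
    by apply: choice_value_ext cx => //; apply: sep.
  - by case: vs3 => _ [].
  - move=> k s' kb ag xk bk.
    have vs' : vars_ok a b r s' by exact: vars_agree ag vs3.
    exact: try_cut_ok bk xk kb nsg.
have bn : (b <= n.+1 + n.+1)%N by lia.
rewrite /=; lia.
Qed.

(** The part of the table filled so far, in the order of the three nested loops: [r] decreasing,
    then [b] increasing, then [a] decreasing. *)
Definition solved_from (s : state R) r b a0 : Prop :=
  forall r' a' b', (r' <= n)%N -> (a' < b' <= M)%N ->
    (r < r')%N || (r' == r) && ((b' < b)%N || (b' == b) && (a0 <= a')%N) ->
    solved s a' b' r'.

(** Entries solved earlier remain solved because the entry being written is not among those they
    read: it comes later in the order of filling. *)
Lemma solved_step s s' r a b : (r <= n)%N -> (a < b <= M)%N ->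
  same_except (addr n r a b) s s' -> solved s' a b r ->
  solved_from s r b a.+1 -> solved_from s' r b a.
Proof.
move=> rn abM se sol sf r' a' b' r'n ab'M ord'.
have [e|ne] := eqVneq (r', a', b') (r, a, b); first by case: e => -> -> ->.
rewrite !xpair_eqE in ne.
apply: cell_ok_ext (sf r' a' b' r'n ab'M _) => //; [by case/andP: ab'M| |lia].
move=> a2 b2 r2 h1 h2 h3 h4; apply: se; apply: addr_neq; rewrite ?xpair_eqE; lia.
Qed.

Lemma solve_column_ok s k r : ready s -> nmem s xColumn 0 = k -> nmem s xB 0 = k.+1 ->
  nmem s xR 0 = r -> (k < M)%N -> (r <= n)%N -> solved_from s r k.+1 k.+1 ->
  runs solve_column s (2000 * n.+1 ^ 2) (fun s' => solved_from s' r k.+1 0).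
Proof.
move=> rd hk hB hR kM rn sf.
eapply runs_le.
  eapply runs_weaken; [exact: leqnn| |].
  2: apply: (@runs_for _ (fun j s' => solved_from s' r k.+1 (k.+1 - j)) _ _ _ _ k.+1 _) => //.
  - by move=> s' [+ _]; rewrite subnn.
  - move=> j s' jk ag xj sfj; have rd' : ready s' by exact: ready_agree ag rd.
    apply: runs_seq; apply: runs_step => //.
    set c := assign _ _; set s2 := step c s'.
    have ag2 : agree c s' s2 by exact: step_agree.
    have rd2 : ready s2 by exact: ready_agree ag2 rd'.
    have [ag1 _] := ag.
    have hA2 : nmem s2 xA 0 = (k - j)%N.
      by rewrite /s2 /= /upd /= xj ag1 // hk.
    have hB2 : nmem s2 xB 0 = k.+1 by rewrite /s2 /= /upd /= ag1.
    have hR2 : nmem s2 xR 0 = r by rewrite /s2 /= /upd /= ag1.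
    have abM : (k - j < k.+1 <= M)%N by lia.
    apply: runs_weaken (solve_cell_ok rd2 hA2 hB2 hR2 abM rn) => [|s3 [se sol]].
      exact: leqnn.
    rewrite subSS; apply: (solved_step rn abM se sol).
    have -> : ((k - j).+1 = k.+1 - j)%N by lia.
    exact: sfj.
rewrite /=; nia.
Qed.

Lemma solve_plane_ok s r : ready s -> nmem s xR 0 = r -> (r <= n)%N ->
  (forall r' a b, (r < r' <= n)%N -> (a < b <= M)%N -> solved s a b r') ->
  runs solve_plane s (4500 * n.+1 ^ 3) (fun s' =>
    forall r' a b, (r <= r' <= n)%N -> (a < b <= M)%N -> solved s' a b r').
Proof.
move=> rd hR rn sol.
eapply runs_le.
  eapply runs_weaken; [exact: leqnn| |].
  2: apply: (@runs_for _ (fun k s' => solved_from s' r k.+1 k.+1) _ _ _ _ M _) => //.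
  - move=> s' [sf _] r' a b rr abM; apply: sf => //; lia.
  - exact: ready_M.
  - move=> r' a b r'n abM h; apply: sol => //; lia.
  - move=> k s' kM ag xk sfk; have rd' : ready s' by exact: ready_agree ag rd.
    apply: runs_seq; apply: runs_step => //.
    set c := assign _ _; set s2 := step c s'.
    have ag2 : agree c s' s2 by exact: step_agree.
    have rd2 : ready s2 by exact: ready_agree ag2 rd'.
    have [ag1 _] := ag.
    have hk2 : nmem s2 xColumn 0 = k by rewrite /s2 /=.
    have hB2 : nmem s2 xB 0 = k.+1 by rewrite /s2 /= /upd /= xk addn1.
    have hR2 : nmem s2 xR 0 = r by rewrite /s2 /= /upd /= ag1.
    apply: runs_weaken (solve_column_ok rd2 hk2 hB2 hR2 kM rn _) => [|s3 sf3|].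
    + exact: leqnn.
    + move=> r' a b r'n abM h; apply: sf3 => //; lia.
    + exact: sfk.
rewrite /=; nia.
Qed.

Lemma solve_all_ok s : ready s ->
  runs solve_all s (5000 * n.+1 ^ 4) (fun s' =>
    forall r a b, (r <= n)%N -> (a < b <= M)%N -> solved s' a b r).
Proof.
move=> rd.
eapply runs_le.
  eapply runs_weaken; [exact: leqnn| |].
  2: apply: (@runs_for _ (fun k s' => forall r a b, (n < r + k)%N -> (r <= n)%N ->
       (a < b <= M)%N -> solved s' a b r) _ _ _ _ n.+1 _) => //.
  - move=> s' [sf _] r a b rn abM; apply: sf => //; lia.
  - by rewrite /= (ready_n rd) addn1.
  - move=> r a b; lia.
  - move=> k s' kM ag xk sfk; have rd' : ready s' by exact: ready_agree ag rd.
    apply: runs_seq; apply: runs_step => //.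
    set c := assign _ _; set s2 := step c s'.
    have ag2 : agree c s' s2 by exact: step_agree.
    have rd2 : ready s2 by exact: ready_agree ag2 rd'.
    have hR2 : nmem s2 xR 0 = (n - k)%N by rewrite /s2 /= /upd /= (ready_n rd') xk.
    apply: runs_weaken (solve_plane_ok rd2 hR2 _ _) => [|s3 sf3||].
    + exact: leqnn.
    + move=> r a b h rn abM; apply: sf3 => //; lia.
    + lia.
    + move=> r a b h abM; apply: sfk => //; lia.
rewrite /=; nia.
Qed.

End Solving.

(** * Ranks of keys *)

Section Ranking.
Variables (R : realDomainType) (n : nat) (x : nat -> R).

(** Heavier keys come before lighter ones, and ties are broken by index; this makes the order strict
    and total, hence ranks distinct. *)
Definition precedes (j i : nat) : bool :=
  (j < i)%N && (x i <= x j) || (x i < x j).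

Definition rank (i : nat) : nat := \sum_(j < n) precedes j i.

Lemma precedes_irr i : precedes i i = false.
Proof. by rewrite /precedes ltnn ltxx. Qed.

Lemma precedes_trans i j k : precedes i j -> precedes j k -> precedes i k.
Proof.
rewrite /precedes => /orP[/andP[ij xij]|xij] /orP[/andP[jk xjk]|xjk]; apply/orP.
- by left; rewrite (ltn_trans ij jk) (le_trans xjk).
- by right; apply: lt_le_trans xij.
- by right; apply: le_lt_trans xij.
- by right; apply: lt_trans xij.
Qed.

Lemma precedes_total i j : i != j -> precedes i j || precedes j i.
Proof. by rewrite /precedes neq_ltn => /orP[] ->; case: (ltgtP (x i) (x j)); rewrite ?orbT. Qed.

(** Counting [i] itself as well turns a termwise inequality of indicators into a strict inequality
    for the rank. *)
Lemma rank_succ i (b : nat -> nat) : (i < n)%N ->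
  (forall k, precedes k i + (k == i) <= b k)%N -> (rank i < \sum_(k < n) b k)%N.
Proof.
move=> ilt le; have -> : (rank i).+1 = (\sum_(k < n) (precedes k i + (val k == i)))%N.
  rewrite big_split /= -addn1; congr (_ + _)%N.
  rewrite (bigD1 (Ordinal ilt)) //= eqxx big1 // => k; rewrite -val_eqE /=.
  by move=> /negbTE ->.
by apply: leq_sum => k _; apply: le.
Qed.

Lemma rank_lt i : (i < n)%N -> (rank i < n)%N.
Proof.
move=> ilt; suff : (rank i < \sum_(k < n) 1)%N by rewrite sum1_card card_ord.
apply: (rank_succ (b := fun=> 1%N)) => // k.
by have [->|] := eqVneq k i; [rewrite precedes_irr|case: precedes].
Qed.

Lemma precedes_rank i j : (i < n)%N -> precedes i j -> (rank i < rank j)%N.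
Proof.
move=> ilt ij; apply: (rank_succ (b := fun k => precedes k j)) => // k.
have [->|_] := eqVneq k i; first by rewrite precedes_irr ij.
by case: (boolP (precedes k i)) => // /precedes_trans/(_ ij) ->.
Qed.

Lemma rank_inj i j : (i < n)%N -> (j < n)%N -> rank i = rank j -> i = j.
Proof.
move=> ilt jlt e; have [//|/precedes_total/orP[]] := eqVneq i j.
  by move=> /(precedes_rank ilt); rewrite e ltnn.
by move=> /(precedes_rank jlt); rewrite e ltnn.
Qed.

Lemma rank_weight i j : (j < n)%N -> (rank i <= rank j)%N -> x j <= x i.
Proof.
move=> jlt; apply: contraLR; rewrite -ltNge -ltnNge => ij.
by apply: precedes_rank => //; rewrite /precedes ij orbT.
Qed.

Definition key_of_rank (r : nat) : nat := find (fun i => rank i == r) (iota 0 n).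

(** Ranks map the [n] keys injectively into [n] values, so every value is attained and the search by
    [find] succeeds. *)
Lemma key_of_rankP r : (r < n)%N ->
  (key_of_rank r < n)%N /\ rank (key_of_rank r) = r.
Proof.
move=> rlt; have inj : injective (fun i : 'I_n => Ordinal (rank_lt (ltn_ord i))).
  by move=> i j [] /(rank_inj (ltn_ord i) (ltn_ord j)) /val_inj.
have /codomP[i [ri]] := inj_card_onto inj (leqnn _) (Ordinal rlt).
have hi : has (fun i => rank i == r) (iota 0 n).
  by apply/hasP; exists (val i); rewrite ?mem_iota ?ri //=.
have lt : (key_of_rank r < n)%N by rewrite -[X in (_ < X)%N](size_iota 0) -has_find.
by split=> //; have /eqP := nth_find 0%N hi; rewrite nth_iota.
Qed.

End Ranking.

(** * Initialisation *)

Local Notation xOdd := 30%N (only parsing).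
Local Notation xEven := 31%N (only parsing).

Definition double (e : nexp) : nexp := NAdd e e.
Definition plus (e : nexp) (k : nat) : nexp := NAdd e (NConst k).

(** [i] and [j] index the flags of two interchangeable operators, and [ci] and [cj] are their codes.
    As [cut_op] depends on the parity of the cut only, two values serve all cuts. *)
Definition pick_op (x i j ci cj : nat) : cmd :=
  If (positive (NGet aOps (NConst i))) (assign x (NConst ci))
    (If (positive (NGet aOps (NConst j))) (assign x (NConst cj))
       (assign x (NConst 0))).

Definition prepare : cmd :=
  Seq (assign xM (plus (double (var xN)) 1))
    (Seq (pick_op xOdd 0 3 1 4) (pick_op xEven 1 4 2 5)).

(** The pass for the last gap also fills cells 2n+1 and 2n+2, which lie beyond the last position. *)
Definition fill_positions : cmd :=
  For xI (plus (var xN) 1)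
    (let e := double (var xI) in
     Seq (Seq (NSet aPr e (NGet aGapQ (var xI)))
         (Seq (NSet aPr (plus e 1) (NGet aKeyQ (var xI)))
              (NSet aRk e (var xN))))
    (Seq (Seq (RSet rW e (RGet rAlpha (var xI)))
              (RSet rW (plus e 1) (RGet rBeta (var xI))))
    (Seq (Seq (NSet aKey (plus e 1) (var xI))
              (NSet aKey (plus e 2) (var xI)))
         (Seq (NSet aCut (plus e 1) (var xOdd))
              (NSet aCut (plus e 2) (var xEven)))))).

(** [precedes] on the weights of the keys, with the disjunction expressed through negation and
    conjunction. *)
Definition outranks (j i : nexp) : bexp :=
  BNot (BAnd (BNot (BAnd (BNLt j i) (BNot (BRLt (RGet rBeta j) (RGet rBeta i)))))
             (BNot (BRLt (RGet rBeta i) (RGet rBeta j)))).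

Definition rank_cell : nexp := plus (double (var xI)) 1.

Definition count_rank : cmd :=
  For xJ (var xN)
    (If (outranks (var xJ) (var xI))
        (NSet aRk rank_cell (plus (NGet aRk rank_cell) 1))
        Skip).

Definition fill_ranks : cmd :=
  For xI (var xN)
    (Seq (NSet aRk rank_cell (NConst 0))
    (Seq count_rank (NSet aOrd (NGet aRk rank_cell) (var xI)))).

(** Multiples of the row width by repeated addition. The table goes one entry beyond the largest
    interval end: that entry is the square of the width, the step of [fill_planes]. *)
Definition fill_rows : cmd :=
  For xI (plus (var xM) 1)
    (NSet aRow (plus (var xI) 1)
       (NAdd (NGet aRow (var xI)) (plus (var xM) 1))).

Definition fill_planes : cmd :=
  For xI (plus (var xN) 1)
    (NSet aPlane (plus (var xI) 1)
       (NAdd (NGet aPlane (var xI)) (NGet aRow (plus (var xM) 1)))).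

Definition setup : cmd :=
  Seq prepare (Seq fill_positions (Seq fill_ranks (Seq fill_rows fill_planes))).

Ltac split_eqs :=
  repeat match goal with |- context [@eq_op _ ?x ?y] =>
    case: (@eqP nat x y) => ?; try (exfalso; lia) end.

Section Setup.
Variables (R : realType) (n : nat) (C : pred cmp) (w : nat -> R) (pr : pred nat).

Notation M := (n + n).+1.

Definition rank_of_position (p : nat) : nat :=
  if odd p then rank n (fun i => w (keypos i)) p./2 else n.

Notation ord := (key_of_rank n (fun i => w (keypos i))).

Record initial (s : state R) : Prop := Initial {
  initial_n : nmem s xN 0 = n;
  initial_gap : forall i, (i <= n)%N -> nmem s aGapQ i = pr (i + i);
  initial_key : forall i, (i < n)%N -> nmem s aKeyQ i = pr (keypos i);
  initial_alpha : forall i, (i <= n)%N -> rmem s rAlpha i = w (i + i)%N;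
  initial_beta : forall i, (i < n)%N -> rmem s rBeta i = w (keypos i);
  initial_lt : nmem s aOps 0 = C CLt;
  initial_le : nmem s aOps 1 = C CLe;
  initial_eq : nmem s aOps 2 = C CEq;
  initial_ge : nmem s aOps 3 = C CGe;
  initial_gt : nmem s aOps 4 = C CGt
}.

Lemma initial_agree c s s' :
  all (fun a => a \notin nwrites c) [:: xN; aGapQ; aKeyQ; aOps] ->
  (rAlpha \notin rwrites c) && (rBeta \notin rwrites c) ->
  agree c s s' -> initial s -> initial s'.
Proof.
rewrite /= => /and5P[h1 h2 h3 h4 _] /andP[ha hb] [hn hm].
move=> [i1 i2 i3 i4 i5 i6 i7 i8 i9 i10].
by constructor; rewrite ?hn ?hm.
Qed.

Lemma prepare_ok s : initial s -> runs prepare s (ctime prepare) (fun s' =>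
  [/\ nmem s' xM 0 = M, nmem s' xOdd 0 = cut_op C 1 & nmem s' xEven 0 = cut_op C 2]).
Proof.
move=> ini; apply: runs_step => //=.
have ops := (initial_lt ini, initial_ge ini, initial_le ini, initial_gt ini).
rewrite (initial_n ini) /cut_op /upd /= ?ops addn1.
by case: (C CLt) => /=; [|case: (C CGe) => /=]; rewrite ?ops;
  (case: (C CLe) => /=; [|case: (C CGt) => /=]); rewrite ?ops.
Qed.

Definition filled (s0 s : state R) (i : nat) : Prop :=
  [/\ nmem s aPr (i + i) = nmem s0 aGapQ i,
      nmem s aPr (i + i + 1) = nmem s0 aKeyQ i,
      nmem s aRk (i + i) = n,
      rmem s rW (i + i) = rmem s0 rAlpha i &
  [/\ rmem s rW (i + i + 1) = rmem s0 rBeta i,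
      nmem s aKey (i + i + 1) = i,
      nmem s aKey (i + i + 2) = i,
      nmem s aCut (i + i + 1) = cut_op C 1 &
      nmem s aCut (i + i + 2) = cut_op C 2]]%N.

Lemma fill_positions_ok s : initial s -> 
  nmem s xOdd 0 = cut_op C 1 -> nmem s xEven 0 = cut_op C 2 ->
  runs fill_positions s (200 * n.+1) (fun s' => forall i, (i <= n)%N -> filled s s' i).
Proof.
move=> ini h1 h2; eapply runs_le.
  eapply runs_weaken; [exact: leqnn| |].
  2: apply: (@runs_for _ (fun k s' => forall i, (i < k)%N -> filled s s' i)
     _ _ _ _ n.+1 _) => //.
  - by move=> s' [h _] i lt; apply: h.
  - by rewrite /= (initial_n ini) addn1.
  - move=> k s' kn ag xk fk; have ini' : initial s' by exact: initial_agree ag ini.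
    have [ag1 ag2] := ag.
    apply: runs_step => // i ik.
    have e1 : nmem s' aGapQ = nmem s aGapQ by rewrite ag1.
    have e2 : nmem s' aKeyQ = nmem s aKeyQ by rewrite ag1.
    have e3 : rmem s' rAlpha = rmem s rAlpha by rewrite ag2.
    have e4 : rmem s' rBeta = rmem s rBeta by rewrite ag2.
    have e5 : nmem s' xOdd 0 = cut_op C 1 by rewrite ag1.
    have e6 : nmem s' xEven 0 = cut_op C 2 by rewrite ag1.
    rewrite /filled /= /upd /= xk e1 e2 e3 e4 e5 e6 (initial_n ini').
    have [->|ne] := eqVneq i k; first by split; try split; split_eqs.
    have [f1 f2 f3 f4 [f5 f6 f7 f8 f9]] : filled s s' i by apply: fk; lia.
    by split; try split; split_eqs; rewrite ?f1 ?f2 ?f3 ?f4 ?f5 ?f6 ?f7 ?f8 ?f9.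
rewrite /=; lia.
Qed.

Notation rk := (rank n (fun i => w (keypos i))).

Lemma count_rank_ok s i : initial s -> (i < n)%N -> nmem s xI 0 = i ->
  nmem s aRk (i + i + 1)%N = 0%N ->
  runs count_rank s (100 * n.+1) (fun s' => nmem s' aRk (i + i + 1)%N = rk i /\
    forall p, p != (i + i + 1)%N -> nmem s' aRk p = nmem s aRk p).
Proof.
move=> ini ilt hi h0; eapply runs_le.
  eapply runs_weaken; [exact: leqnn| |].
  2: apply: (@runs_for _ (fun k s' =>
       nmem s' aRk (i + i + 1)%N = (\sum_(j < k) precedes (fun i => w (keypos i)) j i)%N /\
       forall p, p != (i + i + 1)%N -> nmem s' aRk p = nmem s aRk p)
     _ _ _ _ n _) => //.
  - by move=> s' [h _].
  - exact: initial_n.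
  - by rewrite big_ord0.
  - move=> k s' kn ag xk [I1 I2]; have ini' : initial s' by exact: initial_agree ag ini.
    have [ag1 ag2] := ag.
    have hi' : nmem s' xI 0 = i by rewrite ag1.
    have oE : beval s' (outranks (var xJ) (var xI)) = precedes (fun i => w (keypos i)) k i.
      rewrite /outranks !beval_not !beval_and !beval_not !beval_and !beval_not.
      rewrite beval_nlt !beval_rlt !neval_var xk hi' /= hi' xk !(initial_beta ini') //.
      by rewrite negb_and !negbK -leNgt.
    rewrite big_ord_recr /=.
    apply: runs_if; rewrite oE => hk; apply: runs_step => //.
      rewrite hk /= /upd /= hi' I1 eqxx; split=> // p pi.
      by rewrite (negbTE pi) I2.
    by rewrite (negbTE hk) addn0.
rewrite /=; lia.
Qed.

Lemma fill_ranks_ok s : initial s ->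
  (forall i, (i <= n)%N -> nmem s aRk (i + i)%N = n) ->
  runs fill_ranks s (200 * n.+1 ^ 2) (fun s' =>
    (forall p, (p <= n + n)%N -> nmem s' aRk p = rank_of_position p) /\
    (forall r, (r < n)%N -> nmem s' aOrd r = ord r)).
Proof.
move=> ini even; eapply runs_le.
  eapply runs_weaken; [exact: leqnn| |].
  2: apply: (@runs_for _ (fun k s' =>
       (forall i, (i <= n)%N -> nmem s' aRk (i + i)%N = n) /\
       forall i, (i < k)%N -> nmem s' aRk (i + i + 1)%N = rk i /\ nmem s' aOrd (rk i) = i)
     _ _ _ _ n _) => //.
  - move=> s' [[I1 I2] _]; split=> [p pn|r rn].
      have pE : p = (p./2 + p./2 + odd p)%N by rewrite addnn addnC odd_double_half.
      rewrite /rank_of_position; case: (boolP (odd p)) => op; rewrite {1}pE.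
        by rewrite op; have [] := I2 p./2; first by move: op; lia.
      by rewrite (negbTE op) addn0 I1 //; lia.
    have [lt e] := key_of_rankP (fun i => w (keypos i)) rn.
    by have [_] := I2 _ lt; rewrite e.
  - exact: initial_n.
  - move=> k s' kn ag xk [I1 I2]; have ini' : initial s' by exact: initial_agree ag ini.
    apply: runs_seq; apply: runs_step => //; set c := NSet _ _ (NConst 0); set s2 := step c s'.
    have ag2 : agree c s' s2 by exact: step_agree.
    have ini2 : initial s2 by exact: initial_agree ag2 ini'.
    have xk2 : nmem s2 xI 0 = k by [].
    have z2 : nmem s2 aRk (k + k + 1)%N = 0%N by rewrite /s2 /c /= /upd /= xk eqxx.
    have o2 p : p != (k + k + 1)%N -> nmem s2 aRk p = nmem s' aRk p.
      by move=> pk; rewrite /s2 /c /= /upd /= xk (negbTE pk).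
    apply: runs_seq; apply: runs_agree.
    apply: runs_weaken (count_rank_ok ini2 kn xk2 z2) => [|s3 [c1 c2] [ag3 _]].
      exact: leqnn.
    have xk3 : nmem s3 xI 0 = k by rewrite ag3.
    have d3 : nmem s3 aOrd = nmem s' aOrd by rewrite ag3.
    apply: runs_step => //; split=> [i ilt|i ik].
      by rewrite /= /upd /= c2 ?o2 ?I1 //; lia.
    rewrite /= /upd /= xk3 c1 d3.
    have [->|ne] := eqVneq i k; first by rewrite c1 eqxx.
    have ik' : (i < k)%N by lia.
    have [J1 J2] := I2 _ ik'; rewrite c2 ?o2 ?J1; try lia.
    rewrite ifN ?J2 //; apply: contra ne => /eqP e; apply/eqP.
    by apply: rank_inj e => //; lia.
rewrite /=; nia.
Qed.

Lemma fill_rows_ok (s : state R) : nmem s xM 0 = M -> nmem s aRow 0 = 0%N ->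
  runs fill_rows s (100 * n.+1) (fun s' =>
    forall a, (a <= M.+1)%N -> nmem s' aRow a = (a * M.+1)%N).
Proof.
move=> hM h0; eapply runs_le.
  eapply runs_weaken; [exact: leqnn| |].
  2: apply: (@runs_for _ (fun k s' => forall a, (a <= k)%N -> nmem s' aRow a = (a * M.+1)%N)
     _ _ _ _ M.+1 _) => //.
  - by move=> s' [h _].
  - by rewrite /= hM addn1.
  - by move=> a; rewrite leqn0 => /eqP ->.
  - move=> k s' kn ag xk I; have [ag1 _] := ag.
    have hM' : nmem s' xM 0 = M by rewrite ag1.
    apply: runs_step => // a ak; rewrite /= /upd /= xk hM'.
    case: eqP => [->|ne]; last by apply: I; lia.
    by rewrite I // mulnDl mul1n addn1.
rewrite /=; lia.
Qed.

Lemma fill_planes_ok (s : state R) : nmem s xN 0 = n -> nmem s xM 0 = M ->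
  (forall a, (a <= M.+1)%N -> nmem s aRow a = (a * M.+1)%N) -> nmem s aPlane 0 = 0%N ->
  runs fill_planes s (100 * n.+1) (fun s' =>
    forall r, (r <= n.+1)%N -> nmem s' aPlane r = (r * (M.+1 * M.+1))%N).
Proof.
move=> hn hM hrow h0; eapply runs_le.
  eapply runs_weaken; [exact: leqnn| |].
  2: apply: (@runs_for _ (fun k s' => forall a, (a <= k)%N -> nmem s' aPlane a = (a * (M.+1 * M.+1))%N)
     _ _ _ _ n.+1 _) => //.
  - by move=> s' [h _].
  - by rewrite /= hn addn1.
  - by move=> a; rewrite leqn0 => /eqP ->.
  - move=> k s' kn ag xk I; have [ag1 _] := ag.
    have hM' : nmem s' xM 0 = M by rewrite ag1.
    have row' : nmem s' aRow = nmem s aRow by rewrite ag1.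
    apply: runs_step => // a ak; rewrite /= /upd /= xk hM' row'.
    case: eqP => [->|ne]; last by apply: I; lia.
    by rewrite I // addn1 hrow // [(k + 1)%N]addn1 mulSn addnC.
rewrite /=; lia.
Qed.

Lemma setup_ok s : initial s -> nmem s aRow 0 = 0%N -> nmem s aPlane 0 = 0%N ->
  runs setup s (1000 * n.+1 ^ 2) (fun s' =>
  ready n C w pr rank_of_position ord s').
Proof.
move=> ini row0 plane0; eapply runs_le.
  apply: runs_seq; apply: runs_agree.
  apply: runs_weaken (prepare_ok ini) => [|s1 [hM hO hE] ag1]; first exact: leqnn.
  have ini1 : initial s1 by exact: initial_agree ag1 ini.
  apply: runs_seq; apply: runs_agree.
  apply: runs_weaken (fill_positions_ok ini1 hO hE) => [|s2 fl ag2]; first exact: leqnn.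
  have ini2 : initial s2 by exact: initial_agree ag2 ini1.
  have hM2 : nmem s2 xM 0 = M by have [e _] := ag2; rewrite e.
  have ev i : (i <= n)%N -> nmem s2 aRk (i + i)%N = n by move=> /fl[].
  apply: runs_seq; apply: runs_agree.
  apply: runs_weaken (fill_ranks_ok ini2 ev) => [|s3 [rkE ordE] ag3]; first exact: leqnn.
  have ini3 : initial s3 by exact: initial_agree ag3 ini2.
  have row3 : nmem s3 aRow 0 = 0%N.
    by have [e1 _] := ag1; have [e2 _] := ag2; have [e3 _] := ag3; rewrite e3 // e2 // e1.
  have hM3 : nmem s3 xM 0 = M by have [e _] := ag3; rewrite e.
  apply: runs_seq; apply: runs_agree.
  apply: runs_weaken (fill_rows_ok hM3 row3) => [|s4 rowE ag4]; first exact: leqnn.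
  have ini4 : initial s4 by exact: initial_agree ag4 ini3.
  have plane4 : nmem s4 aPlane 0 = 0%N.
    have [e1 _] := ag1; have [e2 _] := ag2; have [e3 _] := ag3; have [e4 _] := ag4.
    by rewrite e4 // e3 // e2 // e1.
  have hM4 : nmem s4 xM 0 = M by have [e _] := ag4; rewrite e.
  apply: runs_agree.
  apply: runs_weaken (fill_planes_ok (initial_n ini4) hM4 rowE plane4) => [|s5 plE ag5]; first exact: leqnn.
  have ini5 : initial s5 by exact: initial_agree ag5 ini4.
  have [n3 r3] := ag3; have [n4 r4] := ag4; have [n5 r5] := ag5.
  have par p : p = (p./2 + p./2 + odd p)%N by rewrite addnn addnC odd_double_half.
  have ckey c : (0 < c <= n + n)%N -> nmem s2 aKey c = c.-1./2 /\ nmem s2 aCut c = cut_op C c.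
    move=> /andP[c0 cn].
    have [_ _ _ _ [_ k1 k2 c1 c2]] : filled s1 s2 c.-1./2 by apply: fl; lia.
    have pE := par c.-1; have oE : odd c = ~~ odd c.-1 by case: (c) c0.
    move: k1 k2 c1 c2; rewrite /cut_op oE; case: (boolP (odd c.-1)) pE => oc pE /=.
      by have -> : (c.-1./2 + c.-1./2 + 2 = c)%N by lia.
    by have -> : (c.-1./2 + c.-1./2 + 1 = c)%N by lia.
  constructor.
  - exact: initial_n ini5.
  - by rewrite n5.
  - move=> p pn; rewrite n5 // n4 // n3 // [in LHS](par p).
    have /fl[f1 f2 _ _ _] : (p./2 <= n)%N by lia.
    case: (boolP (odd p)) => op.
      rewrite f2 (initial_key ini1); last by move: op; lia.
      by congr (nat_of_bool (pr _)); rewrite /keypos -addn1 [RHS]par op.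
    rewrite addn0 f1 (initial_gap ini1); last by lia.
    by congr (nat_of_bool (pr _)); rewrite [RHS]par (negbTE op) addn0.
  - by move=> p pn; rewrite n5 // n4 // rkE.
  - move=> p pn; rewrite r5 // r4 // r3 // [in LHS](par p).
    have /fl[_ _ _ f1 [f2 _ _ _ _]] : (p./2 <= n)%N by lia.
    case: (boolP (odd p)) => op.
      rewrite f2 (initial_beta ini1); last by move: op; lia.
      by congr (w _); rewrite /keypos -addn1 [RHS]par op.
    rewrite addn0 f1 (initial_alpha ini1); last by lia.
    by congr (w _); rewrite [RHS]par (negbTE op) addn0.
  - by move=> r rn; rewrite n5 // n4 // ordE.
  - by move=> c cn; rewrite n5 // n4 // n3 //; have [] := ckey _ cn.
  - by move=> c cn; rewrite n5 // n4 // n3 //; have [] := ckey _ cn.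
  - exact: initial_eq ini5.
  - by move=> a aM; rewrite n5 // rowE //; lia.
  - exact: plE.
rewrite /=; nia.
Qed.

End Setup.

(** * Writing the tree *)

Definition emit (e : nexp) : cmd :=
  Seq (NSet aOut (var xLen) e) (assign xLen (plus (var xLen) 1)).

Definition push (r a b : nexp) : cmd :=
  Seq (Seq (NSet aStR (var xSp) r) (NSet aStA (var xSp) a))
      (Seq (NSet aStB (var xSp) b) (assign xSp (plus (var xSp) 1))).

Definition pop : cmd :=
  Seq (Seq (assign xSp (NSub (var xSp) (NConst 1)))
           (Seq (assign xR (NGet aStR (var xSp)))
                (Seq (assign xA (NGet aStA (var xSp)))
                     (assign xB (NGet aStB (var xSp))))))
      (Seq (assign xK (choice_at (address (var xR) (var xA) (var xB))))
           (assign xC (NSub (var xK) (NConst 3)))).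

Definition push_next_rank : cmd := push (plus (var xR) 1) (var xA) (var xB).
Definition push_left : cmd := push (var xR) (var xA) (var xC).
Definition push_right : cmd := push (var xR) (var xC) (var xB).

(** The stack reverses the order, so the yes-subtree is pushed last in order to be written first. It
    is the left part for the codes 1 and 2 of [CLt] and [CLe], and the right part for [CGe] and
    [CGt]. *)
Definition write_choice : cmd :=
  If (BNLt (var xK) (NConst 2)) (emit (NConst 0))
  (If (BNLt (var xK) (NConst 3)) push_next_rank
  (If (BNLt (var xK) (NConst 4))
    (Seq (emit (NConst 3)) (Seq (emit (NGet aOrd (var xR)))
       (Seq (emit (NConst 0)) push_next_rank)))
    (Seq (emit (NGet aCut (var xC))) (Seq (emit (NGet aKey (var xC)))
       (If (BNLt (NGet aCut (var xC)) (NConst 3))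
          (Seq push_right push_left) (Seq push_left push_right)))))).

Definition write_loop : cmd := While (BNLt (NConst 0) (var xSp)) (Seq pop write_choice).

Definition write_tree : cmd :=
  Seq (Seq (assign xLen (NConst 0)) (assign xSp (NConst 0)))
    (If (positive (choice_at (address (NConst 0) (NConst 0) (var xM))))
       (Seq (push (NConst 0) (NConst 0) (var xM)) write_loop)
       Skip).

(** One pass of the writing loop; the 4 is the time of its guard. *)
Definition write_time := (ctime (Seq pop write_choice) + 4)%N.

Section Writing.
Variables (R : realType) (n : nat) (C : pred cmp) (w : nat -> R).
Variables (pr : pred nat) (rk ord : nat -> nat) (table : nat -> nat).

Notation M := (n + n).+1.
Notation ready := (@ready R n C w pr rk ord).

(** [l] is the stack of pending subproblems, with its top at the end of the list, and [o] is the
    output so far. *)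
Record writing (s : state R) (l : seq (nat * nat * nat)) (o : seq nat) : Prop :=
  Writing {
    writing_ready : ready s;
    writing_table : nmem s aCh = table;
    writing_sp : nmem s xSp 0 = size l;
    writing_stack : forall i, (i < size l)%N ->
      nth (0, 0, 0)%N l i = (nmem s aStR i, nmem s aStA i, nmem s aStB i);
    writing_len : nmem s xLen 0 = size o;
    writing_out : forall i, (i < size o)%N -> nmem s aOut i = nth 0%N o i
  }.

Lemma emit_ok s l o e x : writing s l o -> neval s e = x ->
  writing (step (emit e) s) l (rcons o x).
Proof.
move=> [rd tb sp st le ou] ex; constructor => //.
- by apply: (ready_agree (c := emit e) (s := s)) => //; exact: step_agree.
- by rewrite /= /upd /= le size_rcons addn1.
- move=> i; rewrite size_rcons ltnS => ile; rewrite /= /upd /= ex nth_rcons le.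
  by have [-> | ne] := eqVneq i (size o); rewrite ?ltnn ?eqxx // ou // ltn_neqAle ne ile.
Qed.

Lemma push_ok s l o er ea eb r a b : writing s l o ->
  all (fun x => x \notin nwrites (push er ea eb)) (nreads ea ++ nreads eb) ->
  neval s er = r -> neval s ea = a -> neval s eb = b ->
  writing (step (push er ea eb) s) (rcons l (r, a, b)) o.
Proof.
move=> [rd tb sp st le ou]; rewrite all_cat => /andP[ha hb] hr' ha' hb'.
have ea1 : neval (step (NSet aStR (var xSp) er) s) ea = a.
  rewrite (@neval_agree _ (push er ea eb) s) //.
  by apply: agree_sub (@step_agree _ (NSet aStR (var xSp) er) s isT) => x; rewrite // !inE => ->.
have eb1 : neval (step (Seq (NSet aStR (var xSp) er) (NSet aStA (var xSp) ea)) s) eb = b.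
  rewrite (@neval_agree _ (push er ea eb) s) //.
  apply: agree_sub (@step_agree _ (Seq (NSet aStR (var xSp) er) (NSet aStA (var xSp) ea)) s isT) => x //=.
  by rewrite !inE => /orP[] ->; rewrite ?orbT.
constructor => //.
- by apply: (ready_agree (c := push er ea eb) (s := s)) => //; exact: step_agree.
- by rewrite /= /upd /= sp size_rcons addn1.
- move=> i; rewrite size_rcons ltnS => ile; rewrite nth_rcons.
  move: ea1 eb1; rewrite /= /upd /= sp hr' => -> ->.
  by have [-> | ne] := eqVneq i (size l); rewrite ?ltnn ?eqxx // ltn_neqAle ne ile /= st // ltn_neqAle ne.
Qed.

Lemma pop_ok s l o r a b : writing s (rcons l (r, a, b)) o -> (r <= n)%N -> (a < b <= M)%N ->
  let s' := step pop s in
  [/\ writing s' l o, nmem s' xR 0 = r, nmem s' xA 0 = a, nmem s' xB 0 = b &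
      nmem s' xK 0 = table (addr n r a b) /\ nmem s' xC 0 = (table (addr n r a b) - 3)%N].
Proof.
move=> [rd tb sp st le ou] rn abM.
have rd' : ready (step pop s).
  by apply: (ready_agree (c := pop) (s := s)) => //; exact: step_agree.
have := st (size l); rewrite size_rcons leqnn nth_rcons ltnn eqxx => /(_ isT)[er ea eb].
move: sp; rewrite size_rcons => sp.
have vR : nmem (step pop s) xR 0 = r by rewrite /= /upd /= sp subn1 er.
have vA : nmem (step pop s) xA 0 = a by rewrite /= /upd /= sp subn1 ea.
have vB : nmem (step pop s) xB 0 = b by rewrite /= /upd /= sp subn1 eb.
have vK : nmem (step pop s) xK 0 = table (addr n r a b).
  rewrite /= /upd /= sp subn1 /= -er -ea -eb tb (ready_plane rd) ?(ready_row rd) //; lia.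
split=> //.
  constructor=> //.
  - by rewrite /= /upd /= sp subn1.
  - move=> i ile; have := st i; rewrite size_rcons nth_rcons ile => -> //; lia.
split=> //; by rewrite -vK /= /upd /=.
Qed.

Lemma runs_while_first b c s T1 X (Q : state R -> Prop) : beval s b ->
  runs c s T1 (fun s' => runs (While b c) s' X Q) ->
  runs (While b c) s (btime b + T1 + X) Q.
Proof.
move=> hb [s1 [t1 [e1 l1 [s2 [t2 [e2 l2 q]]]]]].
exists s2, (btime b + t1 + t2)%N; split=> //; first exact: ExecWhileLoop e1 e2.
by rewrite leq_add // leq_add2l.
Qed.

Notation tbl := (fun r a b => table (addr n r a b)).

(* In continuation-passing form, so that the runs for two subtrees compose. *)
Lemma write_loop_ok r a b (T : tree n) k : traced C ord tbl r a b T k ->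
  (r <= n)%N -> (a < b <= M)%N ->
  forall s l o X (Q : state R -> Prop), writing s (rcons l (r, a, b)) o ->
  (forall s', writing s' l (o ++ encode T) -> runs write_loop s' X Q) ->
  runs write_loop s (k * write_time + X) Q.
Proof.
(* The beginning common to all cases: one guard and one [pop], with the remaining passes deferred to
   the postcondition. *)
have start r0 a0 b0 s l o X T1 (Q : state R -> Prop) :
    writing s (rcons l (r0, a0, b0)) o -> (r0 <= n)%N -> (a0 < b0 <= M)%N ->
    (forall s1, writing s1 l o -> nmem s1 xR 0 = r0 -> nmem s1 xA 0 = a0 ->
       nmem s1 xB 0 = b0 -> nmem s1 xK 0 = tbl r0 a0 b0 ->
       nmem s1 xC 0 = (tbl r0 a0 b0 - 3)%N ->
       runs write_choice s1 (ctime write_choice) (fun s' => runs write_loop s' X Q)) ->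
    (write_time + X <= T1)%N -> runs write_loop s T1 Q.
  move=> wr rn abM h le; apply: runs_le le.
  eapply runs_le.
    apply: runs_while_first.
      by rewrite /= (writing_sp wr) size_rcons.
    apply: runs_seq; apply: runs_step => //.
    have [wr' vR vA vB [vK vC]] := pop_ok wr rn abM; exact: h.
  by rewrite leq_add2r /write_time addnC.
elim=> {r a b T k}.
- move=> r a b ch1 rn abM s l o X Q wr cont; apply: (start _ _ _ _ _ _ X _ _ wr rn abM); last by rewrite mul1n.
  move=> s1 wr1 vR vA vB vK vC.
  apply: runs_if; rewrite beval_nlt neval_var vK ch1 // => _.
  by apply: runs_step => //; apply: cont; rewrite cats1; apply: emit_ok.
- move=> r a b T k rn' ch2 tr IH rn abM s l o X Q wr cont.
  apply: (start _ _ _ _ _ _ (k * write_time + X)%N _ _ wr rn abM); last by rewrite mulSn addnA.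
  move=> s1 wr1 vR vA vB vK vC.
  apply: runs_if; rewrite beval_nlt neval_var vK ch2 // => _.
  apply: runs_if; rewrite beval_nlt neval_var vK ch2 // => _.
  apply: runs_step => //; apply: (IH rn' abM _ _ _ _ _ _ cont).
  by apply: (@push_ok s1 l o (plus (var xR) 1) (var xA) (var xB)) => //=; rewrite vR addn1.
- move=> r a b i T k rn' ch3 ordE tr IH rn abM s l o X Q wr cont.
  apply: (start _ _ _ _ _ _ (k * write_time + X)%N _ _ wr rn abM); last by rewrite mulSn addnA.
  move=> s1 wr1 vR vA vB vK vC.
  apply: runs_if; rewrite beval_nlt neval_var vK ch3 // => _.
  apply: runs_if; rewrite beval_nlt neval_var vK ch3 // => _.
  apply: runs_if; rewrite beval_nlt neval_var vK ch3 // => _.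
  have oE : neval s1 (NGet aOrd (var xR)) = i.
    by rewrite /= vR (ready_ord (writing_ready wr1)) // ordE.
  have wr2 := emit_ok (e := NConst 3) wr1 erefl.
  have wr3 := emit_ok (e := NGet aOrd (var xR)) wr2 oE.
  have wr4 := emit_ok (e := NConst 0) wr3 erefl.
  apply: runs_step => //; move: wr4; set s4 := step _ (step _ _) => wr4.
  have uR : neval s4 (plus (var xR) 1) = r.+1.
    exact: etrans (addn1 _) (congr1 S vR).
  apply: (IH rn' abM _ l (rcons (rcons (rcons o 3) i) 0)%N) => [|s' ws'].
    exact: (@push_ok s4 _ _ (plus (var xR) 1) (var xA) (var xB) _ _ _ wr4 isT uR vA vB).
  by apply: cont; move: ws'; rewrite -!cats1 -!catA.
- move=> r a b c op i T U k l0 chc acb opE iE trT IHT trU IHU rn abM s l o X Q wr cont.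
  apply: (start _ _ _ _ _ _ (k * write_time + (l0 * write_time + X))%N _ _ wr rn abM); last by rewrite mulSn mulnDl !addnA.
  move=> s1 wr1 vR vA vB vK vC.
  have c3 : (3 < 3 + c)%N by lia.
  apply: runs_if; rewrite beval_nlt neval_var vK chc => h; first by exfalso; move: h => /=; lia.
  apply: runs_if; rewrite beval_nlt neval_var vK chc => h2; first by exfalso; move: h2 => /=; lia.
  apply: runs_if; rewrite beval_nlt neval_var vK chc => h3; first by exfalso; move: h3 => /=; lia.
  rewrite chc addKn in vC.
  have cn : (0 < c <= n + n)%N by lia.
  have acM : (a < c <= M)%N by lia.
  have cbM : (c < b <= M)%N by lia.
  have cE : neval s1 (NGet aCut (var xC)) = cmp_code op.
    by rewrite /= vC (ready_cut (writing_ready wr1)).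
  have kE : neval s1 (NGet aKey (var xC)) = i.
    by rewrite /= vC (ready_key (writing_ready wr1)).
  have wr2 := emit_ok (e := NGet aCut (var xC)) wr1 cE.
  have wr3 := emit_ok (e := NGet aKey (var xC)) wr2 kE.
  apply: runs_seq; apply: runs_step => //.
  apply: runs_seq; apply: runs_step => //.
  move: wr3; set s3 := step _ (step _ s1) => wr3.
  have uR : nmem s3 xR 0 = r by [].
  have uA : nmem s3 xA 0 = a by [].
  have uB : nmem s3 xB 0 = b by [].
  have uC : nmem s3 xC 0 = c by [].
  move: s3 wr3 uR uA uB uC => s3 wr3 uR uA uB uC.
  have cE3 : neval s3 (NGet aCut (var xC)) = cut_op C c.
    by rewrite /= uC (ready_cut (writing_ready wr3)).
  apply: runs_if; rewrite beval_nlt cE3 => small; apply: runs_seq; apply: runs_step => //;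
    apply: runs_step => //.
    rewrite small in cont.
    have wr4 : writing (step push_right s3) (rcons l (r, c, b)) (rcons (rcons o (cmp_code op)) i).
      exact: (@push_ok s3 _ _ (var xR) (var xC) (var xB)).
    apply: (IHT rn acM).
      exact: (@push_ok _ _ _ (var xR) (var xA) (var xC) r a c wr4).
    move=> s5 ws5; apply: (IHU rn cbM _ _ _ _ _ ws5) => s6 ws6.
    by apply: cont; move: ws6; rewrite -!cats1 -!catA.
  rewrite (negbTE small) in cont; rewrite addnCA.
  have wr4 : writing (step push_left s3) (rcons l (r, a, c)) (rcons (rcons o (cmp_code op)) i).
    exact: (@push_ok s3 _ _ (var xR) (var xA) (var xC)).
  apply: (IHU rn cbM).
    exact: (@push_ok _ _ _ (var xR) (var xC) (var xB) r c b wr4).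
  move=> s5 ws5; apply: (IHT rn acM _ _ _ _ _ ws5) => s6 ws6.
  by apply: cont; move: ws6; rewrite -!cats1 -!catA.
Qed.

End Writing.

Section WriteTree.
Variables (R : realType) (n : nat) (C : pred cmp) (w : nat -> R).
Variables (pr : pred nat) (rk ord : nat -> nat).

Notation M := (n + n).+1.
Notation ready := (@ready R n C w pr rk ord).

Lemma root_address s : ready s ->
  neval s (address (NConst 0) (NConst 0) (var xM)) = addr n 0 0 M.
Proof. by move=> rd; rewrite (neval_address _ rd) //= (ready_M rd). Qed.

Lemma start_writing s : ready s ->
  let s' := step (Seq (assign xLen (NConst 0)) (assign xSp (NConst 0))) s in
  writing n C w pr rk ord (nmem s aCh) s' [::] [::].
Proof.
move=> rd s'; constructor => //.
by apply: (ready_agree (c := Seq (assign xLen (NConst 0)) (assign xSp (NConst 0))) (s := s)) => //; exact: step_agree.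
Qed.

Lemma writing_output T s l o : writing n C w pr rk ord T s l o -> output s = o.
Proof.
move=> wr; apply: (@eq_from_nth _ 0%N); rewrite size_mkseq (writing_len wr) // => i io.
by rewrite nth_mkseq ?(writing_len wr) //; apply: writing_out wr _ io.
Qed.

Lemma write_none s : ready s -> tch n s 0 0 M = 0%N ->
  runs write_tree s (ctime write_tree) (fun s' => output s' = [::]).
Proof.
move=> rd ch0; apply: runs_seq; apply: runs_step => //.
have wr := start_writing rd; set s1 := step _ _ in wr *.
apply: runs_if; rewrite beval_choice (root_address (writing_ready wr)) (writing_table wr).
  by rewrite -/(tch n s 0 0 M) ch0.
by move=> _; apply: runs_step => //; apply: writing_output wr.
Qed.

Lemma write_some s (T : tree n) k : ready s -> traced C ord (tch n s) 0 0 M T k ->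
  (k < M * n.+2)%N -> tch n s 0 0 M != 0%N ->
  runs write_tree s ((4 * write_time + 200) * n.+1 ^ 2) (fun s' => output s' = encode T).
Proof.
move=> rd tr kM ch0; eapply runs_le.
  apply: runs_seq; apply: runs_step => //.
  have wr := start_writing rd; set s1 := step _ _ in wr *.
  apply: runs_if; rewrite beval_choice (root_address (writing_ready wr)) (writing_table wr);
    last first.
    by rewrite -/(tch n s 0 0 M) ch0 => bad; apply: runs_step.
  move=> _; apply: runs_seq; apply: runs_step => //.
  have MM : (0 < M <= M)%N by rewrite leqnn.
  (* The final 4 pays for the guard that fails on the empty stack. *)
  apply: (@write_loop_ok R n C w pr rk ord (nmem s aCh) 0 0 M T k tr (leq0n _) MM _ [::] [::] 4).
    apply: (@push_ok _ _ _ _ _ _ _ _ s1 [::] _ (NConst 0) (NConst 0) (var xM)) => //.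
    exact: ready_M (writing_ready wr).
  move=> s2 wr2; exists s2, 4; split=> //; last exact: writing_output wr2.
  by apply: ExecWhileDone; rewrite /= (writing_sp wr2).
(* The number of passes is below (2n+1)(n+2), which is at most 4(n+1)^2. *)
have h : (k * write_time <= 4 * n.+1 ^ 2 * write_time)%N.
  by apply: leq_mul => //; nia.
have q1 : (0 < n.+1 ^ 2)%N by rewrite expn_gt0.
move: h q1; move: (n.+1 ^ 2)%N write_time => q t h q1.
rewrite [(4 * t + 200)%N]addnC mulnDl; have -> : (4 * t * q = 4 * q * t)%N by lia.
rewrite /=; lia.
Qed.

End WriteTree.

(** * Queries and positions *)

Local Open Scope classical_set_scope.

Lemma sum_ltn n m : (m <= n)%N -> (\sum_(j < n) (j < m) = m)%N.
Proof.
move=> mn; rewrite -[RHS](card_ord m) -sum1_card (big_ord_widen n (fun=> 1%N) mn).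
by rewrite [RHS]big_mkcond; apply: eq_bigr => j _; case: (_ < _)%N.
Qed.

Fixpoint psearch n (T : tree n) (p : nat) : seq bool :=
  match T with
  | Leaf => [::]
  | Node o i y z =>
      let b := ptest o p (keypos i) in b :: psearch (if b then y else z) p
  end.

(** Two positions give the same answers exactly when they stay together in the narrowing sets down
    to a leaf. *)
Lemma pvalidE n C (S : pred nat) (T : tree n) : pvalid C S T <->
  uses_only C T /\ forall p q, S p -> S q -> psearch T p = psearch T q -> p = q.
Proof.
elim: T S => [|o i y IHy z IHz] S /=.
  by split=> [h|[_ h] p q Sp Sq]; [split=> // p q Sp Sq _|]; apply: h.
split=> [[Co /IHy[uy hy] /IHz[uz hz]]|[/and3P[Co uy uz] h]].
  split; first by rewrite Co uy.
  move=> p q Sp Sq [tpq]; rewrite -tpq; case: ifP => tp e.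
    by apply: hy e; rewrite ?Sp ?Sq -?tpq tp.
  by apply: hz e; rewrite ?Sp ?Sq -?tpq tp.
split=> //.
  apply/IHy; split=> // p q /andP[Sp tp] /andP[Sq tq] e.
  by apply: h => //; rewrite tp tq e.
apply/IHz; split=> // p q /andP[Sp /negbTE tp] /andP[Sq /negbTE tq] e.
by apply: h => //; rewrite tp tq e.
Qed.

(** Exchange of summation: charging each node the weight reaching it is the same as charging each
    position the length of its path. *)
Lemma pcostE (R : realDomainType) n (w : nat -> R) (S : pred nat) (T : tree n) :
  pcost w S T = \sum_(p < (n + n).+1 | S p) (size (psearch T p))%:R * w p.
Proof.
elim: T S => [|o i y IHy z IHz] S /=; first by rewrite big1 // => p _; rewrite mul0r.
rewrite IHy IHz /wt -addrA.
rewrite [RHS](bigID (fun p : 'I__ => ptest o p (keypos i))) /=.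
rewrite [X in X + _](bigID (fun p : 'I__ => ptest o p (keypos i))) /= addrACA.
by congr (_ + _); rewrite -big_split /=; apply: eq_bigr => p /andP[_];
  [move=> ->|move=> /negbTE ->]; rewrite -natr1 mulrDl mul1r addrC.
Qed.

Section Positions.
Variables (R : realType) (n : nat) (I : instance R n).

Notation M := (n + n).+1.

(* The number of keys below [v] plus the number of keys at most [v]: twice [i]
   on the gap numbered [i], and [keypos i] at [key I i]. *)
Definition position (v : R) : nat :=
  (\sum_(j < n) ((key I j < v)%R + (key I j <= v)%R))%N.

Lemma key_le (i j : 'I_n) : (i <= j)%N -> key I i <= key I j.
Proof.
rewrite leq_eqVlt => /orP[/eqP/val_inj -> //|/(@key_increasing R n I)/ltW //].
Qed.

(** Both [position v] and [a + b] are sums of two indicators per key, so they can be compared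
    termwise. *)
Lemma position_bounds (a b : nat) v : (a <= n)%N -> (b <= n)%N ->
  ((forall j : 'I_n, ((j < a) <= (key I j < v)%R)%N /\ ((j < b) <= (key I j <= v)%R)%N) ->
   (a + b <= position v)%N) /\
  ((forall j : 'I_n, ((key I j < v)%R <= (j < a))%N /\ ((key I j <= v)%R <= (j < b))%N) ->
   (position v <= a + b)%N).
Proof.
move=> an bn; have -> : (a + b = \sum_(j < n) ((j < a) + (j < b)))%N.
  by rewrite big_split /= !sum_ltn.
by split=> h; apply: leq_sum => j _; have [h1 h2] := h j; apply: leq_add.
Qed.

(** With [position_gt], this reduces every comparison of a query with a key to a comparison of
    positions. *)
Lemma position_ge (i : 'I_n) v : (keypos i <= position v)%N = (key I i <= v).
Proof.
have iltn := ltn_ord i.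
have iSn : (i.+1 <= n)%N by [].
have iln : (i <= n)%N by exact: ltnW.
apply/idP/idP; last first.
  move=> iv; rewrite /keypos -addnS.
  have [+ _] := @position_bounds i i.+1 v iln iSn; apply=> j; split.
    by case: (ltnP j i) => // ji; rewrite (lt_le_trans _ iv) // key_increasing.
  by rewrite ltnS; case: (leqP j i) => // ji; rewrite (le_trans _ iv) // key_le.
apply: contraLR; rewrite -ltNge -leqNgt => vi.
have [_ h] := @position_bounds i i v iln iln; apply: leq_trans (h _) _ => // j.
case: (ltnP j i) => ji; first by split; apply: leq_b1.
have vj : v < key I j by apply: lt_le_trans vi (key_le ji).
by rewrite ltNge (ltW vj) leNgt vj.
Qed.

Lemma position_gt (i : 'I_n) v : (keypos i < position v)%N = (key I i < v).
Proof.
have iltn := ltn_ord i.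
have iSn : (i.+1 <= n)%N by [].
have iln : (i <= n)%N by exact: ltnW.
apply/idP/idP; last first.
  move=> iv; have -> : (keypos i).+1 = (i.+1 + i.+1)%N by rewrite /keypos addnS.
  have [+ _] := @position_bounds i.+1 i.+1 v iSn iSn; apply=> j; rewrite ltnS.
  case: (leqP j i) => // ji.
  have jv : key I j < v by apply: le_lt_trans (key_le ji) iv.
  by rewrite jv (ltW jv).
apply: contraLR; rewrite -leNgt -leqNgt => vi.
have -> : keypos i = (i + i.+1)%N by rewrite /keypos addnS.
have [_ h] := @position_bounds i i.+1 v iln iSn; apply: (h _) => j.
rewrite ltnS; split.
  case: (ltnP j i) => ji; first by apply: leq_b1.
  by rewrite ltNge (le_trans vi (key_le ji)).
case: (leqP j i) => ji; first by apply: leq_b1.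
by rewrite leNgt (le_lt_trans vi (@key_increasing R n I _ _ ji)).
Qed.

Lemma position_le v : (position v <= n + n)%N.
Proof.
have [_ h] := @position_bounds n n v (leqnn _) (leqnn _).
by apply: h => j; rewrite ltn_ord; split; apply: leq_b1.
Qed.

Lemma test_position o v i : cmp_test o v (key I i) = ptest o (position v) (keypos i).
Proof.
case: o => /=.
- by rewrite ltNge -position_ge -ltnNge.
- by rewrite leNgt -position_gt -leqNgt.
- by rewrite eq_le leNgt -position_gt -position_ge -leqNgt eqn_leq.
- by rewrite position_ge.
- by rewrite position_gt.
Qed.

Lemma search_position T v : search I T v = psearch T (position v).
Proof.
elim: T => // o i y IHy z IHz /=; rewrite test_position.
by case: ifP => _; rewrite ?IHy ?IHz.
Qed.

Lemma position_eq u v : position u = position v <->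
  forall i : 'I_n, [/\ (u < key I i) = (v < key I i), (u == key I i) = (v == key I i)
    & (u > key I i) = (v > key I i)].
Proof.
split=> [e i|h].
  by rewrite -![(_ < key _ _)]/(cmp_test CLt _ _) -![_ == _]/(cmp_test CEq _ _) !test_position
    -!position_gt e.
apply: eq_bigr => j _; have [h1 h2 h3] := h j.
by rewrite !leNgt h1 h3.
Qed.

Lemma position_key (i : 'I_n) v : position v = keypos i <-> v = key I i.
Proof.
have := test_position CEq v i => /= h; split=> [e|e]; apply/eqP.
  by rewrite h e.
by rewrite -h e.
Qed.

Lemma position_gap (i : 'I_n.+1) v : gap I i v <-> position v = (i + i)%N.
Proof.
split=> [g|e j].
  have iln : (i <= n)%N by rewrite -ltnS.
  apply/eqP; rewrite eqn_leq; have [h1 h2] := @position_bounds i i v iln iln.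
  apply/andP; split; [apply: h2|apply: h1] => j; have := g j; case: ifP => // _ jv.
  - by split; apply: leq_b1.
  - by rewrite ltNge (ltW jv) leNgt jv.
  - by rewrite jv (ltW jv).
case: ifP => ji.
  by rewrite -position_gt e /keypos; lia.
by rewrite ltNge -position_ge e /keypos -ltnNge; lia.
Qed.

Definition present (p : nat) : bool := `[< exists2 v, queries I v & position v = p >].

Lemma correct_pvalid T : correct I T <-> pvalid (allowed I) present T.
Proof.
rewrite pvalidE; split=> -[u h]; split=> //.
  move=> _ _ /asboolP[a Qa <-] /asboolP[b Qb <-] e.
  by apply/position_eq; apply: h => //; rewrite !search_position.
move=> a b Qa Qb; rewrite !search_position => e; apply/position_eq.
by apply: h e; apply/asboolP; [exists a|exists b].
Qed.

Definition level (p : nat) : set (measurableTypeR R) := [set v | position v = p].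

Lemma level_gap (i : 'I_n.+1) : level (i + i)%N = gap I i.
Proof. by apply/seteqP; split=> v /position_gap. Qed.

Lemma level_key (i : 'I_n) : level (keypos i) = [set key I i].
Proof. by apply/seteqP; split=> v /position_key. Qed.

Lemma position_cases p : (p <= n + n)%N ->
  (exists i : 'I_n.+1, p = (i + i)%N) \/ (exists i : 'I_n, p = keypos i).
Proof.
move=> pn; have E := odd_double_half p; rewrite -addnn in E.
case: (boolP (odd p)) E => op E; [right|left].
  have ilt : (p./2 < n)%N by lia.
  by exists (Ordinal ilt); rewrite /keypos /=; lia.
have ilt : (p./2 < n.+1)%N by lia.
by exists (Ordinal ilt) => /=; lia.
Qed.

Lemma measurable_level p : (p <= n + n)%N -> measurable (level p).
Proof.
move=> /position_cases[[i ->]|[i ->]]; last by rewrite level_key; exact: measurable_set1.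
rewrite level_gap.
have -> : gap I i = \bigcap_(j in [set: 'I_n])
    (if (j < i)%N then `]key I j, +oo[%classic else `]-oo, key I j[%classic).
  apply/seteqP; split=> v g j.
    by move=> _; have := g j; case: ifP => _; rewrite /= in_itv /= ?andbT.
  by have := g j Logic.I; case: ifP => _; rewrite /= in_itv /= ?andbT.
apply: fin_bigcap_measurable => // j _.
by case: ifP => _; exact: measurable_itv.
Qed.

(** * Expected cost as a weighted sum over positions *)

Section Cost.
Variable P : probability (measurableTypeR R) R.
Hypothesis law : query_law I P.

Definition weight (p : nat) : R := fine (P (level p)).

Lemma weight_ge0 p : 0 <= weight p.
Proof. exact/fine_ge0/measure_ge0. Qed.

Lemma weight_gap (i : 'I_n.+1) : weight (i + i) = alpha I i.
Proof. by have [_ _ h] := law; rewrite /weight level_gap h. Qed.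

Lemma weight_key (i : 'I_n) : weight (keypos i) = beta I i.
Proof. by have [_ h _] := law; rewrite /weight level_key h. Qed.

Lemma weight_absent p : (p <= n + n)%N -> ~~ present p -> weight p = 0.
Proof.
move=> pn np; have [h _ _] := law; rewrite /weight h //; first exact: measurable_level.
apply/seteqP; split=> v // [lv Qv]; case/negP: np; apply/asboolP; by exists v.
Qed.

(** The number of comparisons is a simple function, constant on the measurable levels, so its
    expectation is a finite sum over all positions. Restricting the sum to positions that occur
    among the queries is harmless, as the others have weight 0. *)
Lemma cost_pcost T : cost I P T = (pcost weight present T)%:E.
Proof.
rewrite pcostE /cost unlock.
pose f (p : 'I_M) (v : measurableTypeR R) : \bar R :=
  ((size (psearch T p))%:R * \1_(level p) v)%:E.
have mlev (p : 'I_M) : measurable (level p).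
  by apply: measurable_level; rewrite -ltnS.
under eq_integral => v _.
  have -> : ((size (search I T v))%:R : R)%:E = (\sum_(p < M) f p v)%E.
    rewrite sumEFin search_position; congr EFin.
    have vM : (position v < M)%N by rewrite ltnS position_le.
    rewrite (bigD1 (Ordinal vM)) //= indicE mem_set // mulr1 big1 ?addr0 // => p pv.
    rewrite indicE memNset ?mulr0 // => /= e.
    by case/eqP: pv; apply: val_inj.
  over.
rewrite ge0_integral_sum //; last 2 first.
- by move=> p; apply/measurable_EFinP; apply: measurable_funM => //.
- by move=> p v _; rewrite lee_fin mulr_ge0.
rewrite -sumEFin [RHS]big_mkcond; apply: eq_bigr => p _.
have pn : (p <= n + n)%N by rewrite -ltnS.
under eq_integral do rewrite /f EFinM.
rewrite ge0_integralZl_EFin //; last first.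
- by apply/measurable_EFinP; exact: measurable_indic.
have PE : P (level p) = (weight p)%:E by rewrite /weight fineK // fin_num_measure.
rewrite integral_indic // setIT [X in (_ * X)%E]PE -EFinM.
by case: ifP => // /negbT np; rewrite weight_absent // mulr0.
Qed.

End Cost.

End Positions.

(** * Correctness of the program *)

Definition program : cmd := Seq setup (Seq solve_all write_tree).

Lemma at_natE (X : Type) n (x0 : X) (f : 'I_n -> X) i (lt : (i < n)%N) :
  at_nat x0 f i = f (Ordinal lt).
Proof. by rewrite /at_nat insubT. Qed.

Section Correctness.
Variables (R : realType) (n : nat) (I : instance R n).
Variable P : probability (measurableTypeR R) R.
Hypothesis law : query_law I P.

Notation M := (n + n).+1.
Let w := weight I P.
Let pr : pred nat := present I.
Let x i := w (keypos i).
Let rk := rank_of_position n w.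
Let ord := key_of_rank n x.

Lemma initial_input : initial n (allowed I) w pr (input_state I).
Proof.
constructor=> //= i ile.
- rewrite (at_natE _ _ (ile : (i < n.+1)%N)); congr nat_of_bool; apply: asbool_equiv_eq; split.
    by move=> [v [/position_gap g Qv]]; exists v.
  move=> [v Qv g]; exists v; split=> //.
  by apply/(position_gap I (Ordinal (ile : (i < n.+1)%N))).
- rewrite (at_natE _ _ (ile : (i < n)%N)); congr nat_of_bool; apply: asbool_equiv_eq; split.
    by move=> Qk; exists (key I (Ordinal ile)) => //; apply/(position_key I (Ordinal ile)).
  by move=> [v Qv e]; have <- : v = key I (Ordinal ile) by apply/(position_key I (Ordinal ile)).
- by rewrite (at_natE _ _ (ile : (i < n.+1)%N)) -(weight_gap law).
- by rewrite (at_natE _ _ (ile : (i < n)%N)) -(weight_key law).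
Qed.

Lemma half_keypos i : (keypos i)./2 = i.
Proof. by rewrite /keypos /= addnn uphalf_double. Qed.

Lemma rk_keypos i : rk (keypos i) = rank n x i.
Proof. by rewrite /rk /rank_of_position odd_keypos half_keypos. Qed.

Lemma ord_rk r : (r < n)%N -> (ord r < n)%N /\
  forall p, (p <= n + n)%N -> (rk p == r) = (p == keypos (ord r)).
Proof.
move=> rn; have [lt e] := key_of_rankP x rn; split=> // p pn.
have [->|ne] := eqVneq p (keypos (ord r)); first by rewrite rk_keypos e eqxx.
apply/negP => /eqP; rewrite /rk /rank_of_position.
case: (boolP (odd p)) => op; last by move=> nr; rewrite nr ltnn in rn.
have E := odd_double_half p; rewrite op -addnn in E.
rewrite -e => eq_rank; case/eqP: ne.
have ilt : (p./2 < n)%N by lia.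
have h : p./2 = ord r := rank_inj ilt lt eq_rank.
by rewrite /keypos -h; lia.
Qed.

Lemma sub_present : sub pr rk 0 M 0 = pr.
Proof.
apply/funext => p; rewrite /sub /= leq0n andbT ltnS andbC.
by case: (boolP (pr p)) => // /asboolP[v _ <-]; rewrite position_le.
Qed.

(** The root entry bounds the cost of every correct tree from below and is attained by the tree read
    off the choices. If its code is 0, a correct tree would contradict the lower bound. *)
Lemma optimal_from_table (s : state R) :
  (forall r a b, (r <= n)%N -> (a < b <= M)%N ->
     solved n (allowed I) w pr rk ord s a b r) ->
  if tch n s 0 0 M == 0%N then ~ exists T : tree n, correct I T else
  exists T k, [/\ traced (allowed I) ord (tch n s) 0 0 M T k,
    (k < M * n.+2)%N & optimal I P T].
Proof.
move=> sol; have rk_lt i : (i < n)%N -> (rk (keypos i) < n)%N.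
  by move=> ilt; rewrite rk_keypos; apply: rank_lt.
have rk_wt i j : (i < n)%N -> (j < n)%N -> (rk (keypos i) <= rk (keypos j))%N ->
    w (keypos j) <= w (keypos i).
  by move=> _ jlt; rewrite !rk_keypos; apply: rank_weight.
have w0 p : 0 <= w p by exact: weight_ge0.
have ok a b r : (a < b <= M)%N -> (r <= n)%N ->
    cell_ok n (allowed I) w pr rk ord (tch n s) (tF n s) a b r.
  by move=> abM rn; exact: sol.
have MM : (0 < M <= M)%N by rewrite leqnn.
have lower T : correct I T -> tch n s 0 0 M != 0%N /\ tF n s 0 0 M <= pcost w pr T.
  move=> /correct_pvalid /(ctree_of_tree w0)[t vt ct].
  have [] := table_lower_bound w0 ord_rk rk_lt rk_wt ok MM (leq0n _) (t := t).
    by rewrite sub_present.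
  by rewrite sub_present => h1 h2; split=> //; apply: le_trans ct.
case: eqP => [c0 [T /lower[]]|/eqP c0]; first by rewrite c0.
have [T [k [tr vT cT kT]]] := traced_ok ord_rk ok MM (leq0n _) c0.
rewrite !subn0 in kT; rewrite sub_present in vT cT.
exists T, k; split=> //; split; first by apply/correct_pvalid.
move=> T' /lower[_ le]; rewrite !(cost_pcost law) lee_fin.
by rewrite -/w -/pr cT.
Qed.

(** The constant collects 1000 for the setup, 5000 for the table, and [4 * write_time] plus at most
    1200 for writing the tree, rounded up. *)
Lemma program_ok : runs program (input_state I) ((4 * write_time + 3 * 3000) * n.+1 ^ 4)
  (fun s => optimal_output I P (output s)).
Proof.
have ini := initial_input.
have pow : (n.+1 ^ 2 <= n.+1 ^ 4)%N by rewrite leq_pexp2l.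
have pow1 : (0 < n.+1 ^ 4)%N by rewrite expn_gt0.
eapply runs_le.
  apply: runs_seq.
  eapply runs_weaken; [exact: leqnn| |exact: (setup_ok ini erefl erefl)].
  move=> s1 rd1; apply: runs_seq; apply: runs_agree.
  eapply runs_weaken; [exact: leqnn| |exact: (solve_all_ok rd1)].
  move=> s2 sol ag2.
  have rd2 := ready_agree (c := solve_all) isT isT ag2 rd1.
  apply: (@runs_le _ _ _ (ctime write_tree + (4 * write_time + 200) * n.+1 ^ 2)%N);
    last exact: leqnn.
  have := optimal_from_table sol; case: eqP => [c0 none|/eqP c0 [T [k [tr kT opt]]]].
    apply: runs_weaken (write_none rd2 c0) => [|s3 ->]; first exact: leq_addr.
    by split.
  apply: runs_weaken (write_some rd2 tr kT c0) => [|s3 ->]; first exact: leq_addl.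
  split=> [_|]; first by exists T.
  by case; exists T; case: opt.
have tw : (ctime write_tree <= 1000)%N by vm_compute.
move: tw pow pow1; move: (ctime write_tree) write_time (n.+1 ^ 2)%N (n.+1 ^ 4)%N => A t q r A1 qr r1.
have tqr : (4 * t * q <= 4 * t * r)%N by rewrite leq_mul2l qr orbT.
rewrite (mulnDl _ _ r) (mulnDl _ _ q); lia.
Qed.

End Correctness.

Theorem theorem1 :
  exists (prog : cmd) (c : nat),
    forall (R : realType) (n : nat) (I : instance R n)
           (P : probability (measurableTypeR R) R),
      query_law I P ->
      exists (s : state R) (t : nat),
        [/\ exec prog (input_state I) s t,
            (0 < n)%N -> (t <= c * n ^ 4)%N
          & optimal_output I P (output s)].
Proof.
(* For positive [n], [n.+1] is at most 2n, hence the factor [2 ^ 4]. *)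
exists program, ((4 * write_time + 3 * 3000) * 2 ^ 4)%N => R n I P law.
have [s [t [e le out]]] := program_ok law; exists s, t; split=> // n0.
apply: leq_trans le _; rewrite -mulnA leq_mul2l -expnMn leq_exp2r //.
by apply/orP; right; lia.
Qed.
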